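(* For $0\le v\le1$ put $r=\min\{v,1-v\}$, $R=\max\{v,1-v\}$, and for $x>0$ put $$K(x)=\frac{(x+1)^2}{4x},\quad m_v(x)=1+\frac{2^v v(1-v)(x-1)^2}{(x+1)^{v+1}},\quad M_v(x)=1+\frac{v(1-v)(x-1)^2}{2x^{v+1}}.$$ The following statements are true. (I-i) If $\frac34\le v\le1$ and $A,B$ are strictly positive operators with $A\le B$, then $$r(A+B-2A\sharp B)+A\sharp_vB\le v(B-A)A^{-1}\left(\frac{A-A\natural_{v-1}B}{2}\right)+A\sharp_vB.$$ (I-ii) If $\frac23\le v\le1$ and $A,B$ are strictly positive operators with $A\le B$, then $$v(B-A)A^{-1}\left(A-A^{\frac12}\left(\frac{I+A^{-\frac12}BA^{-\frac12}}{2}\right)^{v-1}A^{\frac12}\right)+A\sharp_vB\le R(A+B-2A\sharp B)+A\sharp_vB.$$ (I-iii) If $0\le v\le\frac13$ and $A,B$ are strictly positive operators with $A\le B$, then the inequality displayed in (I-ii) also holds. (II) If $0\le v\le 1$, $x>0$ and $x^v\ge\frac12$, then $M_v(x)\le K(x)$. (III) If $0\le v\le\frac12$ and $0<x\le1$, then $M_v(x)\le\exp\left(4v(1-v)(K(x)-1)\right)$. (IV) There is no ordering between $m_v(x)$ and $K(x)^{r}$, nor between $M_v(x)$ and $K(x)^{R}$, for $0\le v\le1$ and $0<x\le1$: there exist pairs $(v,x)\in[0,1]\times(0,1]$ with $m_v(x)>K(x)^r$ and pairs with $m_v(x)<K(x)^r$, and there exist pairs $(v,x)\in[0,1]\times(0,1]$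 with $M_v(x)<K(x)^R$ and pairs with $M_v(x)>K(x)^R$.
   Context: Operators are bounded linear operators on a Hilbert space $\mathcal{H}$; strictly positive means positive and invertible; $X\le Y$ means $Y-X$ is positive; $I$ is the identity. For strictly positive $A,B$: $A\sharp_vB=A^{1/2}(A^{-1/2}BA^{-1/2})^vA^{1/2}$ for $0\le v\le 1$, $A\sharp B=A\sharp_{1/2}B$, and $A\natural_pB=A^{1/2}(A^{-1/2}BA^{-1/2})^pA^{1/2}$ for real $p$. *)

(* Defs.v *)
From HB Require Import structures.
From mathcomp Require Import all_boot all_order all_algebra.
From mathcomp Require Import complex.
From mathcomp Require Import all_classical all_reals all_analysis.

Set Implicit Arguments.
Unset Strict Implicit.
Unset Printing Implicit Defensive.

Import Order.TTheory GRing.Theory Num.Theory.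
Import numFieldNormedType.Exports.

Local Open Scope classical_set_scope.
Local Open Scope complex_scope.
Local Open Scope ring_scope.

(* A complex Hilbert space is a complete normed space over R[i] together with
   an inner product (linear in the first variable) inducing its norm. *)
Definition hilbert (R : realType) (H : completeNormedModType R[i])
    (dot : {dot H for @Num.conj R[i]}) : Prop :=
  forall x : H, dot x x = `|x| ^+ 2.

(* Operators are represented by plain functions H -> H, with their pointwise
   module structure; their product is composition and I is idfun. *)
Section Operators.
Context {R : realType} {H : completeNormedModType R[i]}.
Implicit Types (S T A B : H -> H) (p v : R) (f : R -> R).

Definition bounded_op T : Prop :=
  linear T /\ exists M : R, forall x : H, `|T x| <= M%:C * `|x|.

Definition is_inverse T S : Prop :=
  [/\ bounded_op S, S \o T = idfun & T \o S = idfun].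

Definition invertible T : Prop := exists S, is_inverse T S.

(* Junk value 0 when T is not invertible. *)
Definition op_inv T : H -> H := xget (0 : H -> H) [set S | is_inverse T S].

Definition spectrum T : set R[i] := [set z | ~ invertible (z *: idfun - T)].

Definition poly_op (q : {poly R}) T : H -> H :=
  \sum_(i < size q) (q`_i)%:C *: iter i T.

(* Continuous functional calculus for a self-adjoint T (whose spectrum is
   real) and a real function f continuous on the spectrum: S = f(T) is the limit
   in operator norm of q(T), for real polynomials q converging to f uniformly on
   the spectrum. *)
Definition is_fun_calc f T S : Prop :=
  bounded_op S /\
  forall e : R, 0 < e ->
    exists q : {poly R},
      (forall t : R, spectrum T t%:C -> `|f t - q.[t]| <= e) /\
      (forall x : H, `|S x - poly_op q T x| <= e%:C * `|x|).

(* Junk value 0 when f(T) is undefined. *)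
Definition fun_calc f T : H -> H := xget (0 : H -> H) [set S | is_fun_calc f T S].

Definition op_pow T p : H -> H := fun_calc (fun t => t `^ p) T.

Definition natural p A B : H -> H :=
  op_pow A (1 / 2) \o
  op_pow (op_pow A (- (1 / 2)) \o B \o op_pow A (- (1 / 2))) p \o
  op_pow A (1 / 2).

Definition sharp v A B : H -> H := natural v A B.

Definition gmean A B : H -> H := sharp (1 / 2) A B.

Variable dot : {dot H for @Num.conj R[i]}.

(* On R[i], 0 <= z means that z is real and nonnegative. *)
Definition positive_op T : Prop :=
  bounded_op T /\ forall x : H, 0 <= dot (T x) x.

Definition strictly_positive T : Prop := positive_op T /\ invertible T.

Definition op_le S T : Prop := positive_op (T - S).

End Operators.

Section Scalars.
Context {R : realType}.
Implicit Types v x : R.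

Definition kantorovich x : R := (x + 1) ^+ 2 / (4 * x).

Definition lower_m v x : R :=
  1 + 2 `^ v * v * (1 - v) * (x - 1) ^+ 2 / (x + 1) `^ (v + 1).

Definition upper_M v x : R :=
  1 + v * (1 - v) * (x - 1) ^+ 2 / (2 * x `^ (v + 1)).

End Scalars.

(* Main.v *)
Require Import Defs.
From mathcomp Require Import all_boot all_order all_algebra.
From mathcomp Require Import complex.
From mathcomp Require Import all_classical all_reals all_analysis.
From mathcomp Require Import ring lra.

(** The operator inequalities reduce to scalar ones.  Put E = A^(1/2),
    D = A^(-1/2) and X = D B D.  Then A = E E, B = E X E and, since A <= B,
    X >= 1.  Both sides of each inequality in (I), once the common summand
    A #_v B is removed, have the form E F E with F a function of X: for
    instance A + B - 2 (A # B) = E (1 + X - 2 X^(1/2)) E, and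
    (B - A) A^-1 (E G E) = E (X - 1) G E.  As E is self-adjoint, it is enough
    to compare the two functions on [1, +oo[, which contains the spectrum of
    X.  The comparisons are gap_le_power_defect_scalar (Bernoulli's inequality
    in the fourth root of t), midpoint_defect_le_gap_large (a cubic inequality in
    the square root of t) and midpoint_defect_le_gap_small (comparison of powers,
    then a quadratic inequality).

    This needs the continuous functional calculus of a self-adjoint T, for a
    definition in which polynomials approximate f only on the spectrum of T.
    Everything rests on poly_op_ge0: a real polynomial q that is nonnegative
    on the spectrum satisfies q(T) >= 0.  For q nonconstant and a nonzero space,
    let l be the infimum of the quadratic form of q(T) on the unit sphere.  Then
    q(T) - l is positive but not bounded below, hence not invertible.  On the
    other hand, if l < 0, every complex root z of q - l lies outside the spectrum of T, which is real, so q(T) - l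
    is a product of invertible factors T - z: a contradiction.  Applied to
    e^2 - q^2, this bounds the norm of q(T) by the supremum of |q| on the
    spectrum (poly_op_le), whence uniqueness, products and positivity in the
    calculus; completeness of the space gives existence for every uniform limit
    of polynomials on the spectrum.  Such approximations of real powers on a
    compact interval of positive reals come from Bernstein polynomials
    (weierstrass, powR_quadratic_modulus).

    Part (II) is 2 v (1 - v) <= 1/2 <= x^v.  In part (III) the exponent is
    y = v (1 - v) (x - 1)^2 / x, and M_v(x) - 1 = y / (2 x^v).  If x^v >= 1/2,
    1 + y <= exp y suffices; otherwise x <= 2 v x^(2v), so x is so small that
    the quadratic term of exp y takes over.  Part (IV) is witnessed by the
    points (v, x) = (3/4, 1/4), (1/2, 1/4), (1, 1/4) and (1/2, 1/16). *)

Set Implicit Arguments.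
Unset Strict Implicit.
Unset Printing Implicit Defensive.

Import Order.TTheory GRing.Theory Num.Theory.
Import numFieldNormedType.Exports.

Local Open Scope classical_set_scope.
Local Open Scope complex_scope.
Local Open Scope ring_scope.

(** * Scalar inequalities *)

Section ScalarInequalities.
Context {R : realType}.
Implicit Types (v x t s p u : R).

(** Bernoulli's inequality.  Multiplied by [x `^ (- p)], it says that the mean
    of [x `^ (- p)] and [x `^ (1 - p)] with weights [1 - p] and [p] is at least 1;
    as the weighted mean of their exponents is 0, [expR_ge1Dx] shows it. *)
Lemma powR_le_affine x p : 0 < x -> 0 <= p <= 1 -> x `^ p <= 1 - p + p * x.
Proof.
move=> x0 /andP[p0 p1]; rewrite /powR gt_eqF //; set L := ln x.
have xE : x = expR L by rewrite /L lnK ?posrE.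
rewrite xE; have {2}-> : L = p * L + (1 - p) * L by ring.
have {1}-> : 1 - p = (1 - p) * (expR (p * L) * expR (- (p * L))).
  by rewrite -expRD subrr expR0 mulr1.
rewrite expRD; have := expR_gt0 (p * L).
have := expR_ge1Dx (- (p * L)); have := expR_ge1Dx ((1 - p) * L).
move: (expR _) (expR (- _)) (expR (p * L)) => a b c ha hb c0.
have -> : (1 - p) * (c * b) + p * (c * a) = c * ((1 - p) * b + p * a) by ring.
have h1 : (1 - p) * (1 - p * L) <= (1 - p) * b by rewrite ler_wpM2l ?subr_ge0.
have h2 : p * (1 + (1 - p) * L) <= p * a by rewrite ler_wpM2l.
by rewrite -[leLHS]mulr1 ler_pM2l //; lra.
Qed.

Lemma powR_half_sqr t : 0 <= t -> t = (t `^ (1 / 2)) ^+ 2.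
Proof. by move=> t0; rewrite -powR_mulrn ?powR_ge0 // -powRrM divfK ?powRr1 // pnatr_eq0. Qed.

Lemma powR_ge1 t p : 1 <= t -> 0 <= p -> 1 <= t `^ p.
Proof. by move=> t1 p0; rewrite -(powRr0 t) ler_powR. Qed.

(** With [a := 1 - v <= 1 / 4] and [u := t `^ (1 / 4)], Bernoulli's inequality
    at [u^-1] with exponent [4 * a] makes both sides proportional to [a]; what
    remains is polynomial in [u] and follows from [u ^+ 2 - 2 * u + 3 >= 0]. *)
Lemma gap_le_power_defect_scalar v t : 3 / 4 <= v <= 1 -> 1 <= t ->
  Num.min v (1 - v) * (1 + t - 2 * t `^ (1 / 2)) <=
  v * ((t - 1) * (2^-1 * (1 - t `^ (v - 1)))).
Proof.
move=> /andP[v1 v2] t1; have t0 : 0 < t by lra.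
have -> : Num.min v (1 - v) = 1 - v by apply/min_idPr; lra.
set s := t `^ (1 / 2); set u := s `^ (1 / 2).
have s0 : 0 <= s by exact: powR_ge0.
have sE : s = u ^+ 2 by rewrite -powR_half_sqr.
have tE : t = u ^+ 4 by rewrite {1}[t]powR_half_sqr ?(ltW t0) // -/s sE -exprM.
have u1 : 1 <= u by apply: powR_ge1; [apply: powR_ge1 |]; lra.
clearbody u s; have u0 : 0 < u by lra.
have hp : t `^ (v - 1) <= 1 - 4 * (1 - v) + 4 * (1 - v) / u.
  have -> : t `^ (v - 1) = u^-1 `^ (4 * (1 - v)).
    have -> : u^-1 = u `^ (-1) by rewrite powR_inv1 ?ltW.
    rewrite -powRrM {1}tE -powR_mulrn ?(ltW u0) // -powRrM.
    by congr (_ `^ _); ring.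
  by apply: powR_le_affine; rewrite ?invr_gt0 //; apply/andP; split; lra.
rewrite -(ler_pM2r u0).
have hq : u * t `^ (v - 1) <= (1 - 4 * (1 - v)) * u + 4 * (1 - v).
  have := ler_wpM2l (ltW u0) hp.
  by have -> : u * (1 - 4 * (1 - v) + 4 * (1 - v) / u) = (1 - 4 * (1 - v)) * u + 4 * (1 - v)
    by field; rewrite gt_eqF.
have -> : v * ((t - 1) * (2^-1 * (1 - t `^ (v - 1)))) * u =
   v / 2 * (t - 1) * (u - u * t `^ (v - 1)) by field.
have h1 : v / 2 * (t - 1) * (4 * (1 - v) * (u - 1)) <= v / 2 * (t - 1) * (u - u * t `^ (v - 1)).
  by rewrite ler_wpM2l //; [rewrite mulr_ge0; lra | lra].
apply: le_trans h1; rewrite tE sE.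
have w0 : 0 <= (1 - v) * ((u - 1) ^+ 2 * (u + 1)).
  by rewrite mulr_ge0 ?subr_ge0 // mulr_ge0 ?sqr_ge0 //; lra.
rewrite -subr_ge0.
have -> : v / 2 * (u ^+ 4 - 1) * (4 * (1 - v) * (u - 1)) - (1 - v) * (1 + u ^+ 4 - 2 * u ^+ 2) * u
  = (1 - v) * ((u - 1) ^+ 2 * (u + 1)) * (2 * v * (u ^+ 2 + 1) - u * (u + 1)) by field.
rewrite mulr_ge0 //; have := ler_wpM2r (sqr_ge0 u) v1; have := sqr_ge0 (u - 1); nra.
Qed.

(** With [s := t `^ (1 / 2)] and [y := (1 + t) / 2], the claim amounts to
    [y `^ (1 - v) <= (s + 1) / 2]; since [1 - v <= 1 / 3], it is enough that
    [y <= ((s + 1) / 2) ^+ 3]. *)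
Lemma midpoint_defect_le_gap_large v t : 2 / 3 <= v <= 1 -> 1 <= t ->
  v * ((t - 1) * (1 - (2^-1 * (1 + t)) `^ (v - 1))) <=
  Num.max v (1 - v) * (1 + t - 2 * t `^ (1 / 2)).
Proof.
move=> /andP[v1 v2] t1; have t0 : 0 <= t by lra.
have -> : Num.max v (1 - v) = v by apply/max_idPl; lra.
have s1 : 1 <= t `^ (1 / 2) by apply: powR_ge1; lra.
have := powR_half_sqr t0; move: (t `^ (1 / 2)) s1 => s s1 tE.
rewrite ler_wpM2l //; first by lra.
have y1 : 1 <= 2^-1 * (1 + t) by lra.
have s2 : 0 < 2^-1 * (s + 1) by lra.
have hy : 2^-1 * (1 + t) <= (2^-1 * (s + 1)) ^+ 3.
  rewrite -subr_ge0.
  have -> : (2^-1 * (s + 1)) ^+ 3 - 2^-1 * (1 + t) = (s - 1) * (s ^+ 2 + 3) / 8 by rewrite tE; field.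
  by rewrite divr_ge0 // mulr_ge0 ?subr_ge0 // addr_ge0 ?sqr_ge0.
have hz : (2^-1 * (1 + t)) `^ (1 - v) <= 2^-1 * (s + 1).
  apply: (@le_trans _ _ ((2^-1 * (1 + t)) `^ (1 / 3))); first by rewrite ler_powR //; lra.
  have -> : 2^-1 * (s + 1) = ((2^-1 * (s + 1)) ^+ 3) `^ (1 / 3).
    rewrite -powR_mulrn ?(ltW s2) // -powRrM.
    have -> : 3 * (1 / 3) = 1 :> R by field.
    by rewrite powRr1 ?(ltW s2).
  by rewrite ge0_ler_powR ?nnegrE ?exprn_ge0 ?(ltW s2) //; lra.
have -> : (2^-1 * (1 + t)) `^ (v - 1) = ((2^-1 * (1 + t)) `^ (1 - v))^-1.
  by rewrite -powRN opprB.
have z0 : 0 < (2^-1 * (1 + t)) `^ (1 - v) by rewrite powR_gt0; lra.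
have hi : (2^-1 * (s + 1))^-1 <= ((2^-1 * (1 + t)) `^ (1 - v))^-1 by rewrite lef_pV2 ?posrE.
have -> : 1 + t - 2 * s = (t - 1) * (1 - (2^-1 * (s + 1))^-1).
  by rewrite tE; field; rewrite gt_eqF //; lra.
by rewrite ler_wpM2l //; lra.
Qed.

(** Replacing [v - 1] by the smaller exponent [-1] turns the claim into
    [v * (s + 1) ^+ 2 <= (1 - v) * (s ^+ 2 + 1)] for [s := t `^ (1 / 2)], which
    holds because [2 * v <= 1 - v]. *)
Lemma midpoint_defect_le_gap_small v t : 0 <= v <= 1 / 3 -> 1 <= t ->
  v * ((t - 1) * (1 - (2^-1 * (1 + t)) `^ (v - 1))) <=
  Num.max v (1 - v) * (1 + t - 2 * t `^ (1 / 2)).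
Proof.
move=> /andP[v1 v2] t1; have t0 : 0 <= t by lra.
have -> : Num.max v (1 - v) = 1 - v by apply/max_idPr; lra.
have s1 : 1 <= t `^ (1 / 2) by apply: powR_ge1; lra.
have := powR_half_sqr t0; move: (t `^ (1 / 2)) s1 => s s1 tE.
have y1 : 1 <= 2^-1 * (1 + t) by lra.
have hz : (2^-1 * (1 + t))^-1 <= (2^-1 * (1 + t)) `^ (v - 1).
  by rewrite -powR_inv1; [rewrite ler_powR //; lra | lra].
apply: (@le_trans _ _ (v * ((t - 1) * (1 - (2^-1 * (1 + t))^-1)))).
  by rewrite ler_wpM2l // ler_wpM2l //; lra.
have t3 : 0 < t + 1 by lra.
have -> : v * ((t - 1) * (1 - (2^-1 * (1 + t))^-1)) = (v * (t - 1) ^+ 2) / (t + 1).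
  by field; rewrite !gt_eqF //; lra.
rewrite ler_pdivrMr // tE -subr_ge0.
have -> : (1 - v) * (1 + s ^+ 2 - 2 * s) * (s ^+ 2 + 1) - v * (s ^+ 2 - 1) ^+ 2 =
  (s - 1) ^+ 2 * ((1 - 3 * v) * (s ^+ 2 + 1) + v * (s - 1) ^+ 2) by ring.
rewrite mulr_ge0 ?sqr_ge0 // addr_ge0 // mulr_ge0 ?sqr_ge0 //; last by rewrite addr_ge0 ?sqr_ge0.
by lra.
Qed.

Lemma upper_M_le_kantorovich v x : 0 <= v <= 1 -> 0 < x -> 1 / 2 <= x `^ v ->
  upper_M v x <= kantorovich x.
Proof.
move=> /andP[v0 v1] x0 hx; rewrite /upper_M /kantorovich.
rewrite powRD; last by apply/implyP => _; rewrite gt_eqF.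
rewrite powRr1 ?(ltW x0) //; move: (x `^ v) hx => c hc.
have c0 : 0 < c by lra.
have -> : (x + 1) ^+ 2 / (4 * x) = 1 + (x - 1) ^+ 2 / (4 * x) by field; rewrite gt_eqF.
rewrite lerD2l ler_pdivrMr ?mulr_gt0 //.
have -> : (x - 1) ^+ 2 / (4 * x) * (2 * (c * x)) = c / 2 * (x - 1) ^+ 2 by field; rewrite gt_eqF.
rewrite ler_wpM2r ?sqr_ge0 //.
by have := sqr_ge0 (2 * v - 1); nra.
Qed.

(** Cubing [1 + y / 3 <= expR (y / 3)] gives the coefficient 1/3, which is large
    enough for the polynomial inequality needed in [upper_M_le_expR]. *)
Lemma expR_ge_quadratic (y : R) : 0 <= y -> 1 + y + y ^+ 2 / 3 <= expR y.
Proof.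
move=> y0; have -> : y = 3%:R * (y / 3) by field.
rewrite expRM_natl; apply: (@le_trans _ _ ((1 + y / 3) ^+ 3)).
  have -> : (1 + y / 3) ^+ 3 = 1 + 3 * (y / 3) + (3 * (y / 3)) ^+ 2 / 3 + (y / 3) ^+ 3 by field.
  by rewrite lerDl exprn_ge0 // divr_ge0.
by apply: lerXn2r; rewrite ?nnegrE ?expR_ge0 ?expR_ge1Dx // addr_ge0 // divr_ge0.
Qed.

(** With [l := ln x], the hypothesis forces [v * l <= - 1 / 2] because
    [1 + v * l <= expR (v * l)], and [x `^ v ^+ 2 / x] is
    [expR (- (1 - 2 * v) * l) >= 1 - (1 - 2 * v) * l]. *)
Lemma powR_small_bound v x : 0 < v <= 1 / 2 -> 0 < x -> x `^ v <= 1 / 2 ->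
  x <= 2 * v * (x `^ v) ^+ 2.
Proof.
move=> /andP[v0 v2] x0; rewrite /powR gt_eqF //.
have xE : x = expR (ln x) by rewrite lnK ?posrE.
rewrite {2}xE; move: (ln x) => l hc; have hl : v * l <= - (1 / 2).
  by have := expR_ge1Dx (v * l); lra.
have -> : expR (v * l) ^+ 2 = expR l * expR (- ((1 - 2 * v) * l)).
  by rewrite -expRM_natl -expRD; congr expR; ring.
rewrite mulrCA -[leLHS]mulr1 ler_pM2l ?expR_gt0 //.
have := expR_ge1Dx (- ((1 - 2 * v) * l)); move: (expR (- _)) => E hE.
have h1 : 2 * v * (1 - (1 - 2 * v) * l) <= 2 * v * E by rewrite ler_wpM2l //; lra.
apply: le_trans h1.
have h2 : (1 - 2 * v) * (v * l) <= (1 - 2 * v) * - (1 / 2) by rewrite ler_wpM2l //; lra.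
by lra.
Qed.

(** When [c := x `^ v] is below 1/2, the quadratic term of the exponential
    leads to [6 * c - 12 * c ^+ 2 <= (1 - c ^+ 2) ^+ 2], which follows from
    [10 * c ^+ 2 - 6 * c + 1 > 0]. *)
Lemma upper_M_le_expR v x : 0 <= v <= 1 / 2 -> 0 < x <= 1 ->
  upper_M v x <= expR (4 * v * (1 - v) * (kantorovich x - 1)).
Proof.
move=> /andP[v0 v2] /andP[x0 x1].
pose y := v * (1 - v) * (x - 1) ^+ 2 / x.
have -> : 4 * v * (1 - v) * (kantorovich x - 1) = y.
  by rewrite /kantorovich /y; field; rewrite gt_eqF.
have vv : 0 <= v * (1 - v) by rewrite mulr_ge0 // subr_ge0; lra.
have y0 : 0 <= y by rewrite /y divr_ge0 ?(ltW x0) // mulr_ge0 ?sqr_ge0.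
apply: le_trans (expR_ge_quadratic y0); rewrite /upper_M.
rewrite powRD; last by apply/implyP => _; rewrite gt_eqF.
rewrite powRr1 ?(ltW x0) //; have c0 : 0 < x `^ v by exact: powR_gt0.
have -> : v * (1 - v) * (x - 1) ^+ 2 / (2 * (x `^ v * x)) = y / (2 * x `^ v).
  by rewrite /y; field; rewrite !gt_eqF.
rewrite -addrA lerD2l ler_pdivrMr ?mulr_gt0 //.
have -> : (y + y ^+ 2 / 3) * (2 * x `^ v) = y * (2 * x `^ v * (1 + y / 3)) by field.
rewrite -[leLHS]mulr1 ler_wpM2l //.
have [hc|hc] := leP (1 / 2) (x `^ v).
  rewrite -[leLHS]mulr1 ler_pM //; first by lra.
  by rewrite lerDl divr_ge0.
have v_gt0 : 0 < v.
  by rewrite lt_def v0 andbT; apply: contraTN hc => /eqP ->; rewrite powRr0 -leNgt; lra.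
have hx : x <= 2 * v * (x `^ v) ^+ 2 by apply: powR_small_bound; rewrite ?v_gt0 // ltW.
have hx2 : x <= (x `^ v) ^+ 2.
  rewrite -powR_mulrn ?powR_ge0 // -powRrM -{1}[x]powRr1 ?(ltW x0) //.
  by rewrite ger_powR ?x0 //; lra.
move: (x `^ v) c0 hc hx hx2 => c c0 hc hx hx2.
have W : (1 - c ^+ 2) ^+ 2 <= (x - 1) ^+ 2.
  rewrite -[(x - 1) ^+ 2]sqrrN opprB ler_sqr ?nnegrE; last 2 first.
  - by rewrite subr_ge0; nra.
  - by rewrite subr_ge0.
  by rewrite lerD2l lerN2.
have C : 6 * c - 12 * c ^+ 2 <= (1 - c ^+ 2) ^+ 2.
  by have := sqr_ge0 (c ^+ 2); have := sqr_ge0 (10 * c - 3); lra.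
have h1 : 3 * (1 - 2 * c) * x <= 3 * (1 - 2 * c) * (2 * v * c ^+ 2).
  by rewrite ler_wpM2l //; lra.
have h2 : 2 * v * c * (3 * (1 - 2 * c) * c) <= 2 * v * c * ((1 - v) * (x - 1) ^+ 2).
  rewrite ler_wpM2l ?mulr_ge0 ?(ltW c0) //.
  have : 2^-1 * (x - 1) ^+ 2 <= (1 - v) * (x - 1) ^+ 2.
    by rewrite ler_wpM2r ?sqr_ge0 //; lra.
  by lra.
have h3 : 3 * (1 - 2 * c) <= 2 * c * y.
  rewrite -(ler_pM2r x0).
  have -> : 2 * c * y * x = 2 * v * c * ((1 - v) * (x - 1) ^+ 2).
    by rewrite /y; field; rewrite gt_eqF.
  by lra.
by lra.
Qed.

Lemma lower_m_gt_kantorovich_powR : exists v x, [/\ 0 <= v <= 1, 0 < x <= 1 &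
  kantorovich x `^ Num.min v (1 - v) < lower_m v x].
Proof.
(* Here K^(1/4) = 5^(1/2)/2 and m = 1 + (27/320) (8/5)^(3/4); as (8/5)^(3/4) is
   at least 7/5, the fraction 161/144 separates these close values. *)
exists (3 / 4), (1 / 4); split; [lra | lra |].
have -> : Num.min (3 / 4) (1 - 3 / 4) = 1 / 4 :> R by rewrite min_r; lra.
have -> : kantorovich (1 / 4) = (5 / 4) ^+ 2 :> R by rewrite /kantorovich; field.
have k : ((5 / 4) ^+ 2) `^ (1 / 4) < 161 / 144 :> R.
  have -> : 161 / 144 = ((161 / 144) ^+ 4) `^ (1 / 4) :> R.
    rewrite -powR_mulrn // -powRrM; have -> : 4%:R * (1 / 4) = 1 :> R by field.
    by rewrite powRr1.
  by rewrite gt0_ltr_powR ?nnegrE //; lra.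
have m : 7 / 5 <= (8 / 5) `^ (3 / 4) :> R.
  have -> : 7 / 5 = ((7 / 5) ^+ 4) `^ (1 / 4) :> R.
    rewrite -powR_mulrn // -powRrM; have -> : 4%:R * (1 / 4) = 1 :> R by field.
    by rewrite powRr1.
  have -> : (8 / 5) `^ (3 / 4) = ((8 / 5) ^+ 3) `^ (1 / 4) :> R.
    by rewrite -powR_mulrn // -powRrM; congr (_ `^ _); field.
  by rewrite ge0_ler_powR ?nnegrE //; lra.
rewrite /lower_m; have -> : 1 / 4 + 1 = 5 / 4 :> R by field.
rewrite powRD; last by apply/implyP => _; rewrite gt_eqF.
rewrite powRr1 //.
have p0 : 0 < (5 / 4) `^ (3 / 4) :> R by rewrite powR_gt0.
have -> : 2 `^ (3 / 4) = (8 / 5) `^ (3 / 4) * (5 / 4) `^ (3 / 4) :> R.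
  by rewrite -powRM //; congr (_ `^ _); field.
move: p0 m k; move: ((5 / 4) `^ (3 / 4)) ((8 / 5) `^ (3 / 4)) (_ `^ (1 / 4)) => p m k p0 hm hk.
have -> : m * p * (3 / 4) * (1 - 3 / 4) * (1 / 4 - 1) ^+ 2 / (p * (5 / 4)) = m * (27 / 320).
  by field; rewrite gt_eqF.
by lra.
Qed.

Lemma lower_m_lt_kantorovich_powR : exists v x, [/\ 0 <= v <= 1, 0 < x <= 1 &
  lower_m v x < kantorovich x `^ Num.min v (1 - v)].
Proof.
exists (1 / 2), (1 / 4); split; [lra | lra |].
have -> : Num.min (1 / 2) (1 - 1 / 2) = 1 / 2 :> R by rewrite min_r; lra.
have -> : kantorovich (1 / 4) = (5 / 4) ^+ 2 :> R by rewrite /kantorovich; field.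
have -> : ((5 / 4) ^+ 2) `^ (1 / 2) = 5 / 4 :> R.
  rewrite -powR_mulrn // -powRrM; have -> : 2%:R * (1 / 2) = 1 :> R by field.
  by rewrite powRr1.
rewrite /lower_m; have -> : 1 / 4 + 1 = 5 / 4 :> R by field.
rewrite powRD; last by apply/implyP => _; rewrite gt_eqF.
rewrite powRr1 //.
have p0 : 0 < (5 / 4) `^ (1 / 2) :> R by rewrite powR_gt0.
have -> : 2 `^ (1 / 2) = (8 / 5) `^ (1 / 2) * (5 / 4) `^ (1 / 2) :> R.
  by rewrite -powRM //; congr (_ `^ _); field.
have m : (8 / 5) `^ (1 / 2) <= 8 / 5 :> R by rewrite ler1_powR //; lra.
move: p0 m; move: ((5 / 4) `^ (1 / 2)) ((8 / 5) `^ (1 / 2)) => p m p0 hm.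
have -> : m * p * (1 / 2) * (1 - 1 / 2) * (1 / 4 - 1) ^+ 2 / (p * (5 / 4)) = m * (9 / 80).
  by field; rewrite gt_eqF.
by lra.
Qed.

Lemma upper_M_lt_kantorovich_powR : exists v x, [/\ 0 <= v <= 1, 0 < x <= 1 &
  upper_M v x < kantorovich x `^ Num.max v (1 - v)].
Proof.
exists 1, (1 / 4); split; [lra | lra |].
have -> : Num.max 1 (1 - 1) = 1 :> R by rewrite max_l; lra.
have k : kantorovich (1 / 4) = 25 / 16 :> R by rewrite /kantorovich; field.
rewrite k powRr1 // /upper_M subrr mulr0 !mul0r addr0; lra.
Qed.

Lemma kantorovich_powR_lt_upper_M : exists v x, [/\ 0 <= v <= 1, 0 < x <= 1 &
  kantorovich x `^ Num.max v (1 - v) < upper_M v x].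
Proof.
exists (1 / 2), (1 / 16); split; [lra | lra |].
have -> : Num.max (1 / 2) (1 - 1 / 2) = 1 / 2 :> R by rewrite max_r; lra.
have -> : kantorovich (1 / 16) = (17 / 8) ^+ 2 :> R by rewrite /kantorovich; field.
have sq (z : R) : 0 <= z -> (z ^+ 2) `^ (1 / 2) = z.
  move=> z0; rewrite -powR_mulrn // -powRrM; have -> : 2%:R * (1 / 2) = 1 :> R by field.
  by rewrite powRr1.
rewrite sq // /upper_M powRD; last by apply/implyP => _; rewrite gt_eqF.
rewrite powRr1 //; have -> : 1 / 16 = (1 / 4) ^+ 2 :> R by field.
by rewrite sq //; lra.
Qed.
End ScalarInequalities.

(** * Polynomial approximation *)

Section Weierstrass.
Context {R : realType}.
Implicit Types (f : R -> R) (g h : nat -> R) (x t a b e p : R).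

(** The Bernstein polynomial of degree [n], in the recursive form given by
    conditioning on the first of [n] independent trials: evaluated at [x], it is
    the expectation of [g] at a binomial variable of parameters [n] and [x]. *)
Fixpoint bernstein (n : nat) (g : nat -> R) : {poly R} :=
  if n is n'.+1 then
    'X * bernstein n' (fun k => g k.+1) + (1 - 'X) * bernstein n' g
  else (g 0%N)%:P.

Lemma bernsteinS n g x : (bernstein n.+1 g).[x] =
  x * (bernstein n (fun k => g k.+1)).[x] + (1 - x) * (bernstein n g).[x].
Proof. by rewrite /= hornerD !hornerM hornerD hornerN hornerX hornerC. Qed.

Lemma bernstein_le n g h x : 0 <= x <= 1 -> (forall k, (k <= n)%N -> g k <= h k) ->
  (bernstein n g).[x] <= (bernstein n h).[x].
Proof.
move=> /andP[x0 x1]; elim: n g h => [|n ih] g h gh; first by rewrite !hornerC gh.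
rewrite !bernsteinS lerD // ler_wpM2l ?subr_ge0 //; apply: ih => k kn; apply: gh => //.
exact: leqW.
Qed.

(** The first two moments of the binomial distribution.  The shift [c] makes
    the induction go through, since the recursion moves the argument by 1. *)
Lemma bernstein_quadratic n a b c d x :
  (bernstein n (fun k => a + b * (k%:R + c - d) ^+ 2)).[x] =
  a + b * (n%:R * x * (1 - x) + (n%:R * x + c - d) ^+ 2).
Proof.
elim: n c => [|n ih] c; first by rewrite hornerC; ring.
rewrite bernsteinS ih.
have -> : (fun k : nat => a + b * (k.+1%:R + c - d) ^+ 2) =
          (fun k : nat => a + b * (k%:R + (c + 1) - d) ^+ 2).
  by apply/funext => k; rewrite -natr1; ring.
by rewrite ih -natr1; ring.
Qed.

(** By monotonicity, the hypothesis on [f] reduces the estimate to the case of a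
    quadratic function, for which the error is the binomial variance
    [x * (1 - x) / n]. *)
Lemma bernstein_approx f e C n x : 0 <= x <= 1 -> 0 <= C ->
  (forall y z, 0 <= y <= 1 -> 0 <= z <= 1 -> `|f y - f z| <= e + C * (y - z) ^+ 2) ->
  `|f x - (bernstein n.+1 (fun k => f (k%:R / n.+1%:R))).[x]| <= e + C / n.+1%:R.
Proof.
move=> /[dup] x01 /andP[x0 x1] C0 hf; set N : R := n.+1%:R.
have N0 : 0 < N by rewrite ltr0n.
pose c := C / N ^+ 2.
have kx k : (k <= n.+1)%N -> `|f x - f (k%:R / N)| <= e + c * (k%:R + 0 - N * x) ^+ 2.
  move=> kn; have k01 : 0 <= k%:R / N <= 1.
    by rewrite divr_ge0 ?(ltW N0) //= ler_pdivrMr // mul1r ler_nat.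
  have -> : c * (k%:R + 0 - N * x) ^+ 2 = C * (x - k%:R / N) ^+ 2.
    by rewrite /c; field; rewrite gt_eqF.
  exact: hf.
have val a b : (bernstein n.+1 (fun k => a + b * (k%:R + 0 - N * x) ^+ 2)).[x] = a + b * (N * x * (1 - x)).
  by rewrite bernstein_quadratic -/N; ring.
have bnd : c * (N * x * (1 - x)) <= C / N.
  have -> : c * (N * x * (1 - x)) = (C / N) * (x * (1 - x)) by rewrite /c; field; rewrite gt_eqF.
  have xx : x * (1 - x) <= 1 by have := mulr_ge0 x0 x0; lra.
  by rewrite ler_piMr ?divr_ge0 ?(ltW N0).
have lo : (bernstein n.+1 (fun k => (f x - e) + (- c) * (k%:R + 0 - N * x) ^+ 2)).[x] <=
   (bernstein n.+1 (fun k => f (k%:R / N))).[x].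
  apply: bernstein_le => // k /kx; rewrite ler_norml => /andP[_ h]; lra.
have hi : (bernstein n.+1 (fun k => f (k%:R / N))).[x] <=
   (bernstein n.+1 (fun k => (f x + e) + c * (k%:R + 0 - N * x) ^+ 2)).[x].
  apply: bernstein_le => // k /kx; rewrite ler_norml => /andP[h _]; lra.
rewrite val mulNr in lo; rewrite val in hi; rewrite ler_norml.
move: lo hi bnd; move: (c * _) (bernstein _ _).[x] (C / N) => u w D lo hi bnd.
by apply/andP; split; lra.
Qed.

(** A form of uniform continuity suited to Bernstein polynomials: the quadratic
    term is controlled by the variance. *)
Definition quadratic_modulus f a b := forall e, 0 < e -> exists2 C, 0 <= C &
  forall x y, a <= x <= b -> a <= y <= b -> `|f x - f y| <= e + C * (x - y) ^+ 2.

Lemma weierstrass f a b : a < b -> quadratic_modulus f a b ->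
  forall e, 0 < e -> exists q : {poly R}, forall t, a <= t <= b -> `|f t - q.[t]| <= e.
Proof.
move=> ab hf e e0; have w0 : 0 < b - a by rewrite subr_gt0.
have e2 : 0 < e / 2 by rewrite divr_gt0.
have [C C0 hC] := hf _ e2.
pose F s := f (a + (b - a) * s); pose D := C * (b - a) ^+ 2.
have D0 : 0 <= D by rewrite mulr_ge0 ?sqr_ge0.
have [n hn] : exists n : nat, D / n.+1%:R <= e / 2.
  have D1 : 0 < D + 1 by rewrite ltr_wpDl.
  have /cvgrPdist_le /(_ _ (divr_gt0 e2 D1))[n _ hn] := @cvg_harmonic R.
  exists n; have := hn n (leqnn _); rewrite /= sub0r normrN ger0_norm //.
  rewrite ler_pdivlMr //; apply: le_trans.
  by rewrite mulrC ler_wpM2l // lerDl.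
exists (bernstein n.+1 (fun k => F (k%:R / n.+1%:R)) \Po ((b - a)^-1 *: ('X - a%:P))) => t /andP[at_ tb].
rewrite horner_comp hornerZ hornerXsubC.
set x := _ * _; have tE : t = a + (b - a) * x by rewrite /x mulVKf ?gt_eqF // addrC subrK.
have x01 : 0 <= x <= 1.
  by rewrite /x mulrC divr_ge0 ?subr_ge0 ?(ltW ab) //= ler_pdivrMr // mul1r lerD2r.
rewrite {1}tE -/(F x); have := @bernstein_approx F (e / 2) D n x x01 D0 _.
move=> h; apply: (le_trans (h _)); last by rewrite [leRHS]splitr lerD2l.
have seg s : 0 <= s <= 1 -> a <= a + (b - a) * s <= b.
  move=> /andP[s0 s1]; rewrite lerDl mulr_ge0 ?(ltW w0) //= -lerBrDl.
  by rewrite ler_piMr // ltW.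
move=> y z hy hz; rewrite /F /D.
have -> : C * (b - a) ^+ 2 * (y - z) ^+ 2 = C * ((a + (b - a) * y) - (a + (b - a) * z)) ^+ 2 by ring.
by apply: hC; apply: seg.
Qed.

(** [L * d <= e + L ^+ 2 / (4 * e) * d ^+ 2] is the arithmetic-geometric mean
    inequality. *)
Lemma lipschitz_quadratic_modulus f a b L : 0 <= L ->
  (forall x y, a <= x <= b -> a <= y <= b -> f x - f y <= L * `|x - y|) ->
  quadratic_modulus f a b.
Proof.
move=> L0 hL e e0; exists (L ^+ 2 / (4 * e)).
  by rewrite divr_ge0 ?sqr_ge0 // mulr_ge0 // ltW.
move=> x y hx hy; apply: (@le_trans _ _ (L * `|x - y|)).
  by rewrite ler_norml hL // andbT lerNl opprB distrC hL.
rewrite -(real_normK (num_real (x - y))); move: `|x - y| => d.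
rewrite -subr_ge0.
have -> : e + L ^+ 2 / (4 * e) * d ^+ 2 - L * d = (2 * e - L * d) ^+ 2 / (4 * e).
  by field; rewrite gt_eqF.
by rewrite divr_ge0 ?sqr_ge0 // mulr_ge0 // ltW.
Qed.

Lemma ln_sub_le x y : 0 < x -> 0 < y -> ln x - ln y <= (x - y) / y.
Proof.
move=> x0 y0; rewrite -ln_div ?posrE // mulrBl divff ?gt_eqF //.
have := @le_ln1Dx R (x / y - 1); rewrite [1 + _]addrC subrK; apply.
by rewrite ltrBrDl subrr divr_gt0.
Qed.

Lemma powR_quadratic_modulus p a b : 0 < a -> quadratic_modulus (fun t => t `^ p) a b.
Proof.
move=> a0; pose K := expR (`|p| * (`|ln a| + `|ln b|)).
apply: (@lipschitz_quadratic_modulus _ _ _ (K * (`|p| / a))).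
  by rewrite mulr_ge0 ?expR_ge0 // divr_ge0 // ltW.
move=> x y /andP[ax xb] /andP[ay yb].
have x0 := lt_le_trans a0 ax; have y0 := lt_le_trans a0 ay.
rewrite /powR !gt_eqF //.
have xK : expR (p * ln x) <= K.
  rewrite ler_expR (le_trans (ler_norm _)) // normrM ler_wpM2l // ler_norml.
  have b0 := lt_le_trans x0 xb.
  have h1 : ln a <= ln x by rewrite ler_ln ?posrE.
  have h2 : ln x <= ln b by rewrite ler_ln ?posrE.
  have := ler_norm (ln b); have := ler_norm (- ln a); rewrite normrN.
  by have := normr_ge0 (ln a); have := normr_ge0 (ln b) => *; apply/andP; split; lra.
have lnle u v : 0 < u -> a <= v -> ln u - ln v <= `|u - v| / a.
  move=> u0 av; have v0 := lt_le_trans a0 av.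
  apply: (le_trans (ln_sub_le u0 v0)); apply: (@le_trans _ _ (`|u - v| / v)).
    by rewrite ler_pM2r ?invr_gt0 // ler_norm.
  by rewrite ler_wpM2l // lef_pV2 ?posrE.
have lnl : `|ln x - ln y| <= `|x - y| / a.
  by rewrite ler_norml lnle // andbT lerNl opprB distrC lnle.
have -> : p * ln y = p * ln x + p * (ln y - ln x) by ring.
rewrite expRD -[X in X - _]mulr1 -mulrBr -mulrA.
have h1 := expR_ge1Dx (p * (ln y - ln x)).
have h2 : 1 - expR (p * (ln y - ln x)) <= `|p| / a * `|x - y|.
  apply: (@le_trans _ _ (`|p| * `|ln x - ln y|)).
    rewrite -normrM; apply: le_trans (ler_norm _); lra.
  by rewrite mulrAC -mulrA ler_wpM2l.
apply: (@le_trans _ _ (expR (p * ln x) * (`|p| / a * `|x - y|))).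
  by rewrite ler_wpM2l ?expR_ge0.
by rewrite ler_wpM2r // mulr_ge0 // divr_ge0 // ltW.
Qed.
End Weierstrass.

(** * Real inner product and norm *)

Section HilbertOperators.
Context {R : realType} {H : completeNormedModType R[i]}.
Variable dot : {dot H for @Num.conj R[i]}.
Hypothesis hd : hilbert dot.
Implicit Types (S T U V P A B D E X F G : H -> H) (x y : H).

(** The real part of the inner product and the real value of the norm turn the
    estimates into inequalities over [R]. *)
Definition rdot x y := complex.Re (dot x y).
Definition rnorm (x : H) := complex.Re `|x|.
Lemma conj_conjc (z : R[i]) : Num.conj z = z^*%C.
Proof. by []. Qed.
Lemma rdotC x y : rdot x y = rdot y x.
Proof. rewrite /rdot hermC /= expr0 mul1r conj_conjc. by case: (dot y x). Qed.
Lemma rdotDl x y z : rdot (x + y) z = rdot x z + rdot y z.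
Proof. by rewrite /rdot linearDl raddfD. Qed.
Lemma rdotZl a x y : rdot (a%:C *: x) y = a * rdot x y.
Proof. rewrite /rdot linearZl_LR /=. by case: (dot x y) => u v /=; rewrite mul0r subr0. Qed.
Lemma rnorm_ge0 x : 0 <= rnorm x.
Proof. by have := normr_ge0 x; rewrite lecE => /andP[]. Qed.
Lemma norm_rnorm x : `|x| = (rnorm x)%:C.
Proof. by rewrite /rnorm RRe_real // normr_real. Qed.
Lemma rdotxx x : rdot x x = rnorm x ^+ 2.
Proof. by rewrite /rdot hd norm_rnorm -rmorphXn. Qed.
Lemma linD (T : H -> H) : linear T -> {morph T : x y / x + y}.
Proof. move=> lT x y. by have := lT 1 x y; rewrite !scale1r. Qed.
Lemma rdotNl x z : rdot (- x) z = - rdot x z.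
Proof. by rewrite /rdot linearNl raddfN. Qed.
Lemma rdotBl x y z : rdot (x - y) z = rdot x z - rdot y z.
Proof. by rewrite rdotDl rdotNl. Qed.
Lemma rdotDr x y z : rdot z (x + y) = rdot z x + rdot z y.
Proof. by rewrite rdotC rdotDl !(rdotC z). Qed.
Lemma rdotBr x y z : rdot z (x - y) = rdot z x - rdot z y.
Proof. by rewrite rdotC rdotBl !(rdotC z). Qed.
Lemma rdotZr a x y : rdot x (a%:C *: y) = a * rdot x y.
Proof. by rewrite rdotC rdotZl rdotC. Qed.
Lemma rdotNr x z : rdot z (- x) = - rdot z x.
Proof. by rewrite rdotC rdotNl rdotC. Qed.
Definition rdotE := (rdotDl, rdotDr, rdotNl, rdotNr, rdotZl, rdotZr).
Lemma rnorm_le a x y : (`|x| <= a%:C * `|y|) = (rnorm x <= a * rnorm y).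
Proof. by rewrite !norm_rnorm -rmorphM lecR. Qed.
Lemma rnormZ a x : rnorm (a *: x) = complex.Re `|a| * rnorm x.
Proof.
by apply: complexI; rewrite -norm_rnorm normrZ norm_rnorm rmorphM /= (RRe_real (normr_real a)).
Qed.
Lemma rnormD x y : rnorm (x + y) <= rnorm x + rnorm y.
Proof. rewrite -lecR rmorphD /= -!norm_rnorm. exact: ler_normD. Qed.
Lemma rnormN x : rnorm (- x) = rnorm x. Proof. by rewrite /rnorm normrN. Qed.
Lemma rnormB x y : rnorm (x - y) <= rnorm x + rnorm y.
Proof. by rewrite -(rnormN y) rnormD. Qed.
Lemma rnormBC x y : rnorm (x - y) = rnorm (y - x).
Proof. by rewrite -rnormN opprB. Qed.
Lemma rnorm_eq0 x : (rnorm x == 0) = (x == 0).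
Proof. by rewrite -(normr_eq0 x) norm_rnorm -(inj_eq (@complexI R)). Qed.
Lemma rnorm_gt0 x : x != 0 -> 0 < rnorm x.
Proof. by rewrite lt_def rnorm_eq0 rnorm_ge0 => ->. Qed.

(** Expand the squared norm of [rnorm y *: x - rnorm x *: y]. *)
Lemma rdot_CS x y : rdot x y <= rnorm x * rnorm y.
Proof.
have [->|y0] := eqVneq y 0.
  have -> : rdot x 0 = 0 by rewrite -(subrr x) rdotBr subrr.
  by rewrite mulr_ge0 ?rnorm_ge0.
have [/eqP|x0] := eqVneq x 0.
  move=> /eqP->; have -> : rdot 0 y = 0 by rewrite rdotC -(subrr x) rdotBr subrr.
  by rewrite mulr_ge0 ?rnorm_ge0.
have hx := rnorm_gt0 x0; have hy := rnorm_gt0 y0.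
have := sqr_ge0 (rnorm ((rnorm y)%:C *: x - (rnorm x)%:C *: y)).
rewrite -rdotxx !rdotE !rdotxx (rdotC y x) => h.
have : 0 <= 2 * (rnorm x * rnorm y) * (rnorm x * rnorm y - rdot x y) by nra.
rewrite pmulr_rge0 ?subr_ge0 // mulr_gt0 // mulr_gt0 //.
Qed.

(** The form in which completeness serves to invert coercive operators and to
    construct the functional calculus. *)
Lemma cauchy_seq_cvg (u : nat -> H) :
  (forall e, 0 < e ->
     exists N, forall n, (N <= n)%N -> rnorm (u n - u N) <= e) ->
  exists l, forall e, 0 < e -> exists N, forall n, (N <= n)%N -> rnorm (u n - l) <= e.
Proof.
move=> hu.
have cu : cauchy (u @ \oo).
  apply: cauchy_exP => e e0.
  have eE : e = (complex.Re e)%:C by rewrite RRe_real // gtr0_real.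
  have e0' : 0 < complex.Re e / 2 by rewrite divr_gt0 // -ltcR -eE.
  have [N hN] := hu _ e0'.
  exists (u N), N => // n /= /hN h; rewrite -ball_normE /ball_ /= distrC norm_rnorm eE ltcR.
  by apply: (le_lt_trans h); rewrite ltr_pdivrMr // ltr_pMr ?ltr1n // -ltcR -eE.
have /cvg_ex[l /cvgrPdist_le hl] : cvg (u @ \oo) by apply: cauchy_cvg.
exists l => e e0; have /hl [N _ hN] : 0 < e%:C by rewrite ltcR.
by exists N => n /hN /=; rewrite distrC norm_rnorm lecR.
Qed.

(** * Bounded and self-adjoint operators *)

Lemma linZ (T : H -> H) a x : linear T -> T (a *: x) = a *: T x.
Proof.
move=> lT; have T0 : T 0 = 0 by apply: (addrI (T 0)); rewrite -linD // !addr0.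
by have := lT a x 0; rewrite T0 !addr0.
Qed.
Lemma linN (T : H -> H) x : linear T -> T (- x) = - T x.
Proof. by move=> lT; rewrite -scaleN1r linZ // scaleN1r. Qed.
Lemma linB (T : H -> H) x y : linear T -> T (x - y) = T x - T y.
Proof. by move=> lT; rewrite linD // linN. Qed.

Lemma bounded_opP (T : H -> H) :
  bounded_op T <-> linear T /\ exists2 M, 0 < M & forall x, rnorm (T x) <= M * rnorm x.
Proof.
split=> -[lT]; split=> //.
  case: b => M hM; exists (Num.max M 1); first by rewrite lt_max ltr01 orbT.
  move=> x; have := hM x; rewrite rnorm_le => /le_trans; apply.
  by rewrite ler_wpM2r ?rnorm_ge0 // le_max lexx.
by case: b => M M0 hM; exists M => x; rewrite rnorm_le.
Qed.
Lemma bounded_comp (S T : H -> H) : bounded_op S -> bounded_op T -> bounded_op (S \o T).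
Proof.
move=> /bounded_opP[lS [M M0 hM]] /bounded_opP[lT [N N0 hN]]; apply/bounded_opP; split.
  by move=> a x y /=; rewrite lT lS.
exists (M * N); first exact: mulr_gt0.
by move=> x /=; rewrite (le_trans (hM _)) // -mulrA ler_wpM2l // ltW.
Qed.
Lemma boundedD (S T : H -> H) : bounded_op S -> bounded_op T -> bounded_op (S + T).
Proof.
move=> /bounded_opP[lS [M M0 hM]] /bounded_opP[lT [N N0 hN]]; apply/bounded_opP; split.
  by move=> a x y; rewrite !fctE lT lS scalerDr addrACA.
exists (M + N); first exact: addr_gt0.
by move=> x; rewrite fctE (le_trans (rnormD _ _)) // mulrDl lerD.
Qed.
Lemma boundedZ (a : R[i]) (T : H -> H) : bounded_op T -> bounded_op (a *: T).
Proof.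
move=> /bounded_opP[lT [N N0 hN]]; split.
  by move=> b x y; rewrite !fctE lT scalerDr !scalerA mulrC.
exists (complex.Re `|a| * N) => x; rewrite rnorm_le fctE rnormZ -mulrA ler_wpM2l //.
by have := normr_ge0 a; rewrite lecE => /andP[].
Qed.
Lemma bounded_id : bounded_op (idfun : H -> H).
Proof. by split; [move=> a x y | exists 1 => x; rewrite rnorm_le mul1r]. Qed.
Lemma boundedN (T : H -> H) : bounded_op T -> bounded_op (- T).
Proof. by move=> /(boundedZ (-1)); rewrite scaleN1r. Qed.
Lemma boundedB (S T : H -> H) : bounded_op S -> bounded_op T -> bounded_op (S - T).
Proof. by move=> bS /boundedN; apply: boundedD. Qed.

Definition selfadj (T : H -> H) := forall x y, dot (T x) y = dot x (T y).

(** Polarization: [dot (T z) z] is real at [z = x + y] and at [z = x + i y]. *)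
Lemma pos_selfadj T : positive_op dot T -> selfadj T.
Proof.
move=> [[lT _] pT] x y.
have herm u v : dot u v = (dot v u)^*%C by rewrite hermC /= expr0 mul1r.
rewrite (herm x).
have r z : complex.Im (dot (T z) z) = 0 by apply: ger0_Im; apply: pT.
have := r (x + y); have := r (x + 'i%C *: y).
rewrite !linD // linZ // !linearDl !linearDr /= !linearZr_LR !linearZl_LR /= !linearZr_LR /=.
have := r x; have := r y.
case: (dot (T x) x) => a1 b1; case: (dot (T y) y) => a2 b2.
case: (dot (T x) y) => a b; case: (dot (T y) x) => c d /= -> ->.
rewrite !(mul0r, mulr0, mul1r, mulr1, oppr0, add0r, addr0, subr0, sub0r, mulN1r, mulrN1).
by move=> h1 h2; congr (_ +i* _); lra.
Qed.
Lemma selfadjP T x y : selfadj T -> rdot (T x) y = rdot x (T y).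
Proof. by rewrite /rdot => ->. Qed.
Lemma selfadj_pos T : bounded_op T -> selfadj T -> (forall x, 0 <= rdot (T x) x) ->
  positive_op dot T.
Proof.
move=> bT sT pT; split=> // x; rewrite lecE pT andbT /=.
have herm u v : dot u v = (dot v u)^*%C by rewrite hermC /= expr0 mul1r.
have := herm (T x) x; rewrite -sT; case: (dot (T x) x) => a b [] /= h.
by apply/eqP; lra.
Qed.
Lemma pos_rdot T x : positive_op dot T -> 0 <= rdot (T x) x.
Proof. by case=> _ /(_ x); rewrite lecE => /andP[]. Qed.
Lemma selfadjD S T : selfadj S -> selfadj T -> selfadj (S + T).
Proof. by move=> sS sT x y; rewrite !fctE linearDl linearDr /= sS sT. Qed.
Lemma selfadjZ a T : selfadj T -> selfadj (a%:C *: T).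
Proof.
move=> sT x y; rewrite !fctE linearZl_LR linearZr_LR /= sT conj_conjc.
by rewrite conjc_real.
Qed.
Lemma selfadj_id : selfadj idfun.
Proof. by []. Qed.
Lemma selfadjN T : selfadj T -> selfadj (- T).
Proof. by move=> sT x y; rewrite !fctE linearNl linearNr /= sT. Qed.
Lemma selfadjB S T : selfadj S -> selfadj T -> selfadj (S - T).
Proof. by move=> sS /selfadjN; apply: selfadjD. Qed.

(** The Cauchy-Schwarz inequality for the form of [P], in the version obtained
    by evaluating this form at [x - k^-1 *: P x]. *)
Lemma positive_sqr_le P k : linear P -> selfadj P -> 0 < k ->
  (forall x, 0 <= rdot (P x) x <= k * rnorm x ^+ 2) ->
  forall x, rnorm (P x) ^+ 2 <= k * rdot (P x) x.
Proof.
move=> lP sP k0 hP x.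
have /andP[h _] := hP (x - k^-1%:C *: P x).
have /andP[_ h2] := hP (P x).
move: h; rewrite linB // linZ // !rdotE.
rewrite [rdot (P (P x)) x]selfadjP // !rdotxx => h.
have kk : k * k^-1 = 1 by rewrite divff // gt_eqF.
have k0' : 0 < k^-1 by rewrite invr_gt0.
set t := k^-1 in kk k0' h.
have h3 : t * t * rdot (P (P x)) (P x) <= t * rnorm (P x) ^+ 2.
  have -> : t * rnorm (P x) ^+ 2 = t * t * (k * rnorm (P x) ^+ 2).
    by rewrite -mulrA (mulrA t k) (mulrC t k) kk mul1r.
  by rewrite ler_wpM2l // mulr_ge0 // ltW.
have h4 : 0 <= rdot (P x) x - t * rnorm (P x) ^+ 2 by lra.
have := mulr_ge0 (ltW k0) h4.
by rewrite mulrBr mulrA kk mul1r subr_ge0.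
Qed.

(** * Invertibility and spectrum *)

Lemma expr_small (k e : R) : 0 <= k < 1 -> 0 < e -> exists N : nat, k ^+ N <= e.
Proof.
move=> /andP[k0 k1] e0; have kn : `|k| < 1 by rewrite ger0_norm.
have /cvgrPdist_le /(_ _ e0) [N _ hN] := cvg_expr kn.
by exists N; have := hN N (leqnn _); rewrite /= sub0r normrN ger0_norm // exprn_ge0.
Qed.

Lemma coercive_lower S c : 0 < c -> (forall x, c * rnorm x ^+ 2 <= rdot (S x) x) ->
  forall x, c * rnorm x <= rnorm (S x).
Proof.
move=> c0 hS x; have := le_trans (hS x) (rdot_CS _ _).
have := rnorm_ge0 x; rewrite le_eqVlt => /predU1P[<-|x0]; first by move=> _; rewrite mulr0 rnorm_ge0.
by rewrite expr2 mulrA ler_pM2r.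
Qed.

Lemma invertible_build S c : bounded_op S -> 0 < c -> (forall x, c * rnorm x <= rnorm (S x)) ->
  (forall y, exists x, S x = y) -> invertible S.
Proof.
move=> [lS _] c0 hS surj.
have [G hG] := choice surj.
have inj x y : S x = S y -> x = y.
  move=> exy; apply/eqP; rewrite -subr_eq0 -rnorm_eq0 eq_le rnorm_ge0 andbT.
  by rewrite -(ler_pM2l c0) mulr0 (le_trans (hS _)) // linB // exy subrr /rnorm normr0.
exists G; split; last by apply/funext => x /=; rewrite hG.
  apply/bounded_opP; split; first by move=> a x y; apply: inj; rewrite lS !hG.
  exists c^-1; first by rewrite invr_gt0.
  by move=> x; rewrite mulrC ler_pdivlMr // mulrC (le_trans (hS _)) // hG.
by apply/funext => x /=; apply: inj; rewrite hG.
Qed.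

Lemma invertible_lower S : invertible S -> exists2 C, 0 < C & forall x, rnorm x <= C * rnorm (S x).
Proof.
move=> [G [/bounded_opP[_ [C C0 hG]] GS _]]; exists C => // x.
by rewrite -{1}[x]/(idfun x) -GS; exact: hG.
Qed.

Lemma invertibleZ a S : linear S -> a != 0 -> invertible S -> invertible (a *: S).
Proof.
move=> lS a0 [G [bG GS SG]]; have lG := bG.1; exists (a^-1 *: G); split.
- exact: boundedZ.
- apply/funext => x /=; rewrite !fctE linZ // scalerA mulVf // scale1r.
  by have /(congr1 (@^~ x)) := GS.
apply/funext => x /=; rewrite !fctE linZ // scalerA mulfV // scale1r.
by have /(congr1 (@^~ x)) := SG.
Qed.

Lemma invertible_comp S T : invertible S -> invertible T -> invertible (S \o T).
Proof.
move=> [G [bG GS SG]] [K [bK KT TK]]; exists (K \o G); split.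
- exact: bounded_comp.
- by rewrite compA -(compA K) GS /= KT.
by rewrite compA -(compA S) TK /= SG.
Qed.

(** A factor of an invertible product is invertible when the factors commute;
    it serves for the factors [z - T] and [z^* - T] of a positive operator. *)
Lemma invertible_factor U V : bounded_op V -> U \o V = V \o U ->
  invertible (U \o V) -> invertible U.
Proof.
move=> bV UV [W [bW WU UW]]; exists (V \o W); split.
- exact: bounded_comp.
- have -> : V \o W = W \o V.
    have e : W \o (U \o V) \o (V \o W) = W \o V \o (U \o V) \o W.
      apply/funext => x /=; congr (W _).
      by have /(congr1 (@^~ (V (W x)))) /= := UV; move=> ->.
    by move: e; rewrite WU -(compA (W \o V)) UW.
  by rewrite -compA -UV WU.
by rewrite compA UW.
Qed.

(** For [K] large, [P := 1 - S / K] satisfies [0 <= P <= k] with [k < 1], so it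
    is a contraction and the iteration [u := u + (y - S u) / K] solves
    [S u = y]. *)
Lemma coercive_invertible S c : bounded_op S -> selfadj S -> 0 < c ->
  (forall x, c * rnorm x ^+ 2 <= rdot (S x) x) -> invertible S.
Proof.
move=> bS sS c0 hS; have low := coercive_lower c0 hS.
have [lS [K0 K00 hK0]] := (bounded_opP S).1 bS.
apply: (invertible_build bS c0 low) => y.
(* Adding c keeps the contraction factor k = 1 - c / K positive. *)
pose K := K0 + c; have K_gt0 : 0 < K by apply: addr_gt0.
pose P := idfun - K^-1%:C *: S; pose k := K0 / K.
have k_gt0 : 0 < k by apply: divr_gt0.
have kE : k = 1 - c / K.
  by rewrite /k -[K0](addrK c) -/K mulrBl divff // gt_eqF.
clearbody k; have k_lt1 : k < 1 by rewrite kE ltrBlDr ltrDl divr_gt0.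
have PE x : P x = x - K^-1%:C *: S x by [].
have bP : bounded_op P by apply: boundedB; [exact: bounded_id | exact: boundedZ].
have sP : selfadj P by apply: selfadjB; [exact: selfadj_id | exact: selfadjZ].
have rP x : rdot (P x) x = rnorm x ^+ 2 - K^-1 * rdot (S x) x by rewrite PE !rdotE rdotxx.
have hP x : 0 <= rdot (P x) x <= k * rnorm x ^+ 2.
  rewrite rP subr_ge0 ler_pdivrMl // kE mulrBl mul1r lerD2l lerN2 mulrAC [_ / K]mulrC.
  rewrite ler_pM2l ?invr_gt0 // hS andbT (le_trans (rdot_CS _ _)) //.
  rewrite expr2 mulrA ler_wpM2r ?rnorm_ge0 // (le_trans (hK0 _)) //.
  by rewrite ler_wpM2r ?rnorm_ge0 // lerDl ltW.
have hcontr x : rnorm (P x) <= k * rnorm x.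
  rewrite -ler_sqr ?nnegrE ?rnorm_ge0 ?mulr_ge0 ?rnorm_ge0 ?(ltW k_gt0) //.
  apply: (le_trans (positive_sqr_le bP.1 sP k_gt0 hP x)); rewrite exprMn expr2 -mulrA.
  by rewrite ler_pM2l //; have /andP[] := hP x.
(* The residual y - S (u n) of the n-th approximation. *)
pose e n := iter n P y.
have eS n : e n.+1 = e n - K^-1%:C *: S (e n) by rewrite /e iterS PE.
have e_le n : rnorm (e n) <= k ^+ n * rnorm y.
  elim: n => [|n ih]; first by rewrite expr0 mul1r.
  by rewrite exprS -mulrA (le_trans (hcontr _)) // ler_pM2l.
pose u n := \sum_(i < n) K^-1%:C *: e i.
have Su n : S (u n) = y - e n.
  elim: n => [|n ih]; first by rewrite /u big_ord0 /e /= subrr -(subrr (0 : H)) linB // !subrr.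
  have -> : u n.+1 = u n + K^-1%:C *: e n by rewrite /u big_ord_recr.
  by rewrite linD // ih linZ // eS opprB -addrA [- e n + _]addrC.
have small d : 0 < d -> exists N, forall n, (N <= n)%N -> rnorm (e n) <= d.
  move=> d0; have y1 : 0 < rnorm y + 1 by apply: ltr_wpDl; rewrite ?rnorm_ge0.
  have [|N hN] := @expr_small k (d / (rnorm y + 1)) _ (divr_gt0 d0 y1).
    by rewrite (ltW k_gt0).
  exists N => n Nn; apply: (le_trans (e_le n)).
  have : k ^+ n <= d / (rnorm y + 1).
    by apply: le_trans hN; rewrite ler_wiXn2l // ltW.
  rewrite ler_pdivlMr // => h; apply: le_trans h.
  by rewrite ler_wpM2l ?exprn_ge0 ?(ltW k_gt0) // lerDl.
have [|l hl] := @cauchy_seq_cvg u.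
  move=> d d0; have [N hN] := small (c * d / 2) (divr_gt0 (mulr_gt0 c0 d0) (ltr0Sn _ 1)).
  exists N => n Nn; rewrite -(ler_pM2l c0) (le_trans (low _)) // linB // !Su.
  rewrite opprB addrC addrA subrK (le_trans (rnormB _ _)) //.
  by have := hN n Nn; have := hN N (leqnn _); lra.
exists l; apply/eqP; rewrite -subr_eq0 -rnorm_eq0 eq_le rnorm_ge0 andbT.
apply/ler_addgt0Pr => d d0; rewrite add0r.
have d2 : 0 < d / 2 by rewrite divr_gt0.
have [N1 h1] := small _ d2; have [N2 h2] := hl _ (divr_gt0 d2 K00).
pose n := maxn N1 N2.
have -> : S l - y = S (l - u n) - e n.
  by rewrite linB // Su opprB addrA [RHS]addrAC addrK.
apply: (le_trans (rnormB _ _)); rewrite [leRHS]splitr lerD ?h1 ?leq_maxl //.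
apply: (le_trans (hK0 _)); rewrite rnormBC mulrC -ler_pdivlMr //.
by rewrite h2 // leq_maxr.
Qed.

(** For [z = a + i b] with [b != 0], the product of [z - T] and its adjoint
    [z^* - T] is [(a - T)^2 + b^2], which is bounded below by [b^2 > 0]. *)
Lemma spectrum_real T z : bounded_op T -> selfadj T -> spectrum T z -> z = (complex.Re z)%:C.
Proof.
move=> bT sT; case: z => a b /= sp.
have [->//|b0] := eqVneq b 0; case: sp.
pose w : R[i] := 0 +i* b.
have zE : a +i* b = a%:C + w.
  by rewrite /w; congr (_ +i* _); rewrite /= ?addr0 ?add0r.
have wE : w * w = - (b ^+ 2)%:C.
  by rewrite /w; apply/eqP; rewrite eq_complex /= !mul0r !mulr0 addr0 oppr0 sub0r expr2 !eqxx.
pose Q := a%:C *: idfun - T.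
have bQ : bounded_op Q by apply: boundedB => //; exact/boundedZ/bounded_id.
have sQ : selfadj Q by apply: selfadjB => //; exact/selfadjZ/selfadj_id.
have lQ := bQ.1.
have UE : (a +i* b) *: idfun - T = Q + w *: idfun.
  by apply/funext => x; rewrite !fctE zE scalerDl addrAC.
rewrite UE; clearbody Q w; pose V := Q - w *: idfun.
have bw : bounded_op (w *: (idfun : H -> H)) by exact/boundedZ/bounded_id.
have e1 : (Q + w *: idfun) \o V = Q \o Q + (b ^+ 2)%:C *: idfun.
  apply/funext => x; rewrite /V /= !fctE /= (linB _ _ lQ) (linZ _ _ lQ) scalerBr scalerA wE.
  by rewrite scaleNr opprK addrA subrK.
have e2 : V \o (Q + w *: idfun) = Q \o Q + (b ^+ 2)%:C *: idfun.
  apply/funext => x; rewrite /V /= !fctE /= (linD lQ) (linZ _ _ lQ) scalerDr scalerA wE.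
  by rewrite scaleNr opprB addrA addrAC addrK.
apply: (@invertible_factor _ V); first exact: boundedB.
  by rewrite e1 e2.
rewrite e1; apply: (@coercive_invertible _ (b ^+ 2)).
- apply: boundedD; [exact: bounded_comp | exact/boundedZ/bounded_id].
- apply: selfadjD; last exact/selfadjZ/selfadj_id.
  by move=> x y /=; rewrite !sQ.
- by rewrite exprn_even_gt0.
move=> x; rewrite !fctE /= !rdotE selfadjP // !rdotxx lerDr.
exact: sqr_ge0.
Qed.

Lemma spectrum_ge T m t : bounded_op T -> selfadj T ->
  (forall x, m * rnorm x ^+ 2 <= rdot (T x) x) -> spectrum T t%:C -> m <= t.
Proof.
move=> bT sT hT sp; rewrite leNgt; apply/negP => tm; apply: sp.
have -> : t%:C *: idfun - T = (-1) *: (T - t%:C *: idfun) by rewrite scaleN1r opprB.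
have bt : bounded_op (T - t%:C *: idfun) by apply: boundedB => //; exact/boundedZ/bounded_id.
apply: invertibleZ; [exact: bt.1 | by rewrite oppr_eq0 oner_eq0 |].
apply: (@coercive_invertible _ (m - t)) => //; last 2 first.
- by rewrite subr_gt0.
- by move=> x; rewrite !fctE /= !rdotE rdotxx mulrBl lerD2r.
by apply: selfadjB => //; exact/selfadjZ/selfadj_id.
Qed.

Lemma spectrum_le T M t : bounded_op T -> selfadj T ->
  (forall x, rdot (T x) x <= M * rnorm x ^+ 2) -> spectrum T t%:C -> t <= M.
Proof.
move=> bT sT hT sp; rewrite leNgt; apply/negP => tm; apply: sp.
apply: (@coercive_invertible _ (t - M)) => //; last 2 first.
- by rewrite subr_gt0.
- by move=> x; rewrite !fctE /= !rdotE rdotxx mulrBl lerD2l lerN2.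
- by apply: boundedB => //; exact/boundedZ/bounded_id.
by apply: selfadjB => //; exact/selfadjZ/selfadj_id.
Qed.

(** * Polynomials of an operator *)

(** Complex coefficients are needed to split real polynomials into linear
    factors. *)
Definition cpoly_op (p : {poly R[i]}) T x : H := \sum_(i < size p) p`_i *: iter i T x.

Lemma cpoly_wide (p : {poly R[i]}) T x n : (size p <= n)%N ->
  cpoly_op p T x = \sum_(i < n) p`_i *: iter i T x.
Proof.
move=> pn; rewrite /cpoly_op (big_ord_widen _ (fun i => p`_i *: iter i T x) pn) big_mkcond /=.
apply: eq_bigr => i _; case: ltnP => // /(nth_default 0) ->; by rewrite scale0r.
Qed.

Lemma cpolyD p q T x : cpoly_op (p + q) T x = cpoly_op p T x + cpoly_op q T x.
Proof.
pose n := maxn (size p) (size q).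
rewrite (@cpoly_wide _ _ _ n) ?size_polyD // (@cpoly_wide p _ _ n) ?leq_maxl //.
rewrite (@cpoly_wide q _ _ n) ?leq_maxr // -big_split; apply: eq_bigr => i _.
by rewrite coefD scalerDl.
Qed.

Lemma cpolyZ a p T x : cpoly_op (a *: p) T x = a *: cpoly_op p T x.
Proof.
rewrite (@cpoly_wide _ _ _ (size p)) ?size_scale_leq // scaler_sumr.
by apply: eq_bigr => i _; rewrite coefZ scalerA.
Qed.

Lemma cpolyMX p T x : cpoly_op (p * 'X) T x = cpoly_op p T (T x).
Proof.
rewrite (@cpoly_wide _ _ _ (size p).+1); last first.
  have [->|p0] := eqVneq p 0; first by rewrite mul0r size_poly0.
  by rewrite size_mulX.
rewrite big_ord_recl coefMX scale0r add0r.
by apply: eq_bigr => i _; rewrite coefMX /= -iterSr.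
Qed.

Lemma cpolyC c T x : cpoly_op c%:P T x = c *: x.
Proof. by rewrite (@cpoly_wide _ _ _ 1) ?size_polyC_leq1 // big_ord1 coefC. Qed.

Lemma cpolyX T x : cpoly_op 'X T x = T x.
Proof. by rewrite -['X]mul1r cpolyMX cpolyC scale1r. Qed.

Lemma cpoly_comm p T x : linear T -> cpoly_op p T (T x) = T (cpoly_op p T x).
Proof.
move=> lT; rewrite /cpoly_op; apply: (big_rec2 (fun u v => u = T v)).
  by rewrite -(subrr (0 : H)) linB // !subrr.
by move=> i u v _ ->; rewrite linD // linZ // -iterSr.
Qed.

(** Multiplicativity makes factorizations over [R[i]] available for [T]. *)
Lemma cpolyM p q T x : linear T -> cpoly_op (p * q) T x = cpoly_op p T (cpoly_op q T x).
Proof.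
move=> lT; elim/poly_ind: p => [|p c ih] in x *.
  by rewrite mul0r /cpoly_op size_poly0 !big_ord0.
rewrite mulrDl !cpolyD mul_polyC cpolyZ cpolyC mulrAC !cpolyMX ih.
by rewrite cpoly_comm.
Qed.

Lemma bounded_cpoly p T : bounded_op T -> bounded_op (cpoly_op p T).
Proof.
move=> bT; elim/poly_ind: p => [|p c ih].
  have -> : cpoly_op 0 T = 0 *: idfun.
    by apply/funext => x; rewrite fctE scale0r /cpoly_op size_poly0 big_ord0.
  exact/boundedZ/bounded_id.
have -> : cpoly_op (p * 'X + c%:P) T = cpoly_op p T \o T + c *: idfun.
  by apply/funext => x; rewrite cpolyD cpolyMX cpolyC.
by apply: boundedD; [exact: bounded_comp | exact/boundedZ/bounded_id].
Qed.

Lemma cpoly_roots (s : seq R[i]) T : bounded_op T ->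
  (forall z, z \in s -> ~ spectrum T z) ->
  invertible (cpoly_op (\prod_(z <- s) ('X - z%:P)) T).
Proof.
move=> bT; elim: s => [|z s ih] hs.
  rewrite big_nil; have -> : cpoly_op 1 T = idfun.
    by apply/funext => x; rewrite cpolyC scale1r.
  by exists idfun; split=> //; exact: bounded_id.
rewrite big_cons.
have -> : cpoly_op (('X - z%:P) * \prod_(j <- s) ('X - j%:P)) T =
   (-1 *: (z *: idfun - T)) \o cpoly_op (\prod_(j <- s) ('X - j%:P)) T.
  apply/funext => x; rewrite (cpolyM _ _ _ bT.1) /=; move: (cpoly_op (\prod_(j <- s) _) T x) => y.
  by rewrite cpolyD cpolyX -polyCN cpolyC scaleN1r opprB !fctE scaleNr.
apply: invertible_comp; last by apply: ih => w ws; apply: hs; rewrite inE ws orbT.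
apply: invertibleZ; last by apply: contrapT; apply: hs; rewrite mem_head.
  by apply: (boundedB _ bT).1; exact/boundedZ/bounded_id.
by rewrite oppr_eq0 oner_eq0.
Qed.

Lemma poly_opE (q : {poly R}) T x :
  poly_op q T x = cpoly_op (map_poly (real_complex R) q) T x.
Proof.
rewrite /poly_op fct_sumE /cpoly_op size_map_poly; apply: eq_bigr => i _.
by rewrite coef_map.
Qed.
Lemma poly_opD (p q : {poly R}) T x : poly_op (p + q) T x = poly_op p T x + poly_op q T x.
Proof. by rewrite !poly_opE rmorphD cpolyD. Qed.
Lemma poly_opZ a (q : {poly R}) T x : poly_op (a *: q) T x = a%:C *: poly_op q T x.
Proof. by rewrite !poly_opE map_polyZ cpolyZ. Qed.
Lemma poly_opC (a : R) T x : poly_op a%:P T x = a%:C *: x.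
Proof. by rewrite poly_opE map_polyC cpolyC. Qed.
Lemma poly_opX T x : poly_op ('X : {poly R}) T x = T x.
Proof. by rewrite poly_opE map_polyX cpolyX. Qed.
Lemma poly_opM (p q : {poly R}) T x : linear T ->
  poly_op (p * q) T x = poly_op p T (poly_op q T x).
Proof. by move=> lT; rewrite !poly_opE rmorphM cpolyM. Qed.
Lemma poly_opN (q : {poly R}) T x : poly_op (- q) T x = - poly_op q T x.
Proof. by rewrite -scaleN1r poly_opZ rmorphN scaleN1r. Qed.

Lemma poly_op_comp (p q : {poly R}) T x : linear T ->
  poly_op (p \Po q) T x = poly_op p (poly_op q T) x.
Proof.
move=> lT; elim/poly_ind: p => [|p c ih] in x *.
  by rewrite comp_poly0 -polyC0 !poly_opC.
rewrite comp_polyD comp_polyM comp_polyX comp_polyC !poly_opD !poly_opC (poly_opM (p \Po q) _ _ lT) ih.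
by rewrite [poly_op (p * 'X) _ _]poly_opE rmorphM /= map_polyX cpolyMX -poly_opE.
Qed.

Lemma bounded_poly_op (q : {poly R}) T : bounded_op T -> bounded_op (poly_op q T).
Proof.
move=> /(bounded_cpoly (map_poly (real_complex R) q)).
by congr bounded_op; apply/funext => x; rewrite poly_opE.
Qed.

Lemma selfadj_poly_op (q : {poly R}) T : bounded_op T -> selfadj T -> selfadj (poly_op q T).
Proof.
move=> bT sT; elim/poly_ind: q => [|q c ih] x y.
  by rewrite -polyC0 !poly_opC !scale0r linear0l linear0r.
rewrite !poly_opD !poly_opC linearDl linearDr /= linearZl_LR linearZr_LR /= conj_conjc conjc_real.
rewrite (poly_opM _ _ x bT.1) [q * 'X]mulrC (poly_opM _ _ y bT.1) !poly_opX.
by rewrite ih sT.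
Qed.

(** * Positivity of polynomials on the spectrum *)

(** By [positive_sqr_le], the form of a positive [S] controls
    [rnorm (S x) ^+ 2], and the inverse of [S] controls [rnorm x] by
    [rnorm (S x)]. *)
Lemma pos_invertible_lower S : bounded_op S -> selfadj S -> invertible S ->
  (forall x, 0 <= rdot (S x) x) ->
  exists2 d, 0 < d & forall x, d * rnorm x ^+ 2 <= rdot (S x) x.
Proof.
move=> /[dup] bS /bounded_opP[lS [k k0 hk]] sS /invertible_lower[C C0 hC] pS.
exists (C ^+ 2 * k)^-1; first by rewrite invr_gt0 mulr_gt0 // exprn_gt0.
move=> x; rewrite ler_pdivrMl ?mulr_gt0 ?exprn_gt0 //.
have : rnorm x ^+ 2 <= (C * rnorm (S x)) ^+ 2.
  by rewrite ler_sqr ?nnegrE ?rnorm_ge0 // mulr_ge0 ?rnorm_ge0 // ltW.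
move=> /le_trans; apply; rewrite exprMn -[leRHS]mulrA ler_pM2l ?exprn_gt0 //.
apply: positive_sqr_le => // y; rewrite pS (le_trans (rdot_CS _ _)) //.
by rewrite expr2 mulrA ler_wpM2r ?rnorm_ge0.
Qed.

(** [l] is the infimum of the quadratic form of [Q] on the unit sphere, obtained
    as a supremum of homogeneous lower bounds so that vectors need not be
    normalized. *)
Lemma sup_lower_form Q : bounded_op Q -> selfadj Q -> (exists x, x != 0) ->
  exists2 l, (forall x, l * rnorm x ^+ 2 <= rdot (Q x) x) &
    ~ exists2 d, 0 < d & (forall x, (l + d) * rnorm x ^+ 2 <= rdot (Q x) x).
Proof.
move=> /bounded_opP[lQ [M M0 hM]] sQ [x0 x00].
pose L := [set l : R | forall x, l * rnorm x ^+ 2 <= rdot (Q x) x].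
have LM : L (- M).
  move=> x; rewrite mulNr lerNl -rdotNl (le_trans (rdot_CS _ _)) // rnormN.
  by rewrite expr2 mulrA ler_wpM2r ?rnorm_ge0.
have n0 : 0 < rnorm x0 ^+ 2 by rewrite exprn_gt0 ?rnorm_gt0.
have ubL : ubound L (rdot (Q x0) x0 / rnorm x0 ^+ 2).
  by move=> l hl; rewrite ler_pdivlMr.
have hsL : has_sup L by split; [exists (- M) | exists (rdot (Q x0) x0 / rnorm x0 ^+ 2)].
exists (sup L).
  move=> x; have [->|xn0] := eqVneq x 0.
    by have := LM 0; rewrite /rnorm normr0 expr0n /= !mulr0.
  have n1 : 0 < rnorm x ^+ 2 by rewrite exprn_gt0 ?rnorm_gt0.
  rewrite -ler_pdivlMr //; apply: ge_sup; first by exists (- M).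
  by move=> l hl; rewrite ler_pdivlMr.
move=> [d d0 hd']; have : sup L + d <= sup L by apply: (ub_le_sup hsL.2).
by rewrite gerDl leNgt d0.
Qed.

(** Nonconstant case.  If the bound [l] of [sup_lower_form] were negative, [q - l]
    would have all its roots outside the spectrum, hence [q(T) - l] would be a
    product of invertible operators, and [l] could be increased. *)
Lemma poly_op_ge0_nonconstant (q : {poly R}) T : bounded_op T -> selfadj T -> (1 < size q)%N ->
  (forall t, spectrum T t%:C -> 0 <= q.[t]) -> forall x, 0 <= rdot (poly_op q T x) x.
Proof.
move=> bT sT sq hq x; have [->|xn0] := eqVneq x 0.
  by rewrite rdotC /rdot linear0l.
pose Q := poly_op q T.
have bQ : bounded_op Q by exact: bounded_poly_op.
have sQ : selfadj Q by exact: selfadj_poly_op.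
have [|l hl nl] := sup_lower_form bQ sQ; first by exists x.
apply: (le_trans _ (hl x)); rewrite mulr_ge0 ?sqr_ge0 // leNgt; apply/negP => l0.
apply: nl; pose S := Q - l%:C *: idfun.
have bS : bounded_op S by apply: boundedB => //; exact/boundedZ/bounded_id.
have sS : selfadj S by apply: selfadjB => //; exact/selfadjZ/selfadj_id.
have rS y : rdot (S y) y = rdot (Q y) y - l * rnorm y ^+ 2.
  by rewrite /S !fctE !rdotE rdotxx.
have iS : invertible S; last first.
  have [|d d0 hd'] := pos_invertible_lower bS sS iS.
    by move=> y; rewrite rS subr_ge0.
  by exists d => // y; have := hd' y; rewrite rS lerBrDl mulrDl.
pose p := map_poly (real_complex R) (q - l%:P).
have sp : (size (q - l%:P) = size q).
  by rewrite size_polyDl // -polyCN (leq_ltn_trans (size_polyC_leq1 _)).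
have p0 : p != 0 by rewrite -size_poly_gt0 size_map_poly sp (ltn_trans _ sq).
have -> : S = cpoly_op p T.
  apply/funext => y; rewrite -poly_opE poly_opD -polyCN poly_opC rmorphN scaleNr.
  by [].
have [r pr] := closed_field_poly_normal p.
have -> : cpoly_op p T = lead_coef p *: cpoly_op (\prod_(z <- r) ('X - z%:P)) T.
  by apply/funext => y; rewrite {1}pr cpolyZ.
apply: invertibleZ; first by have [] := bounded_cpoly (\prod_(z <- r) ('X - z%:P)) bT.
  by rewrite lead_coef_eq0.
apply: cpoly_roots => // z zr sz.
have zE := spectrum_real bT sT sz; move: (complex.Re z) zE => t zE.
have : root p z by rewrite pr rootZ ?lead_coef_eq0 // root_prod_XsubC.
rewrite zE /root horner_map hornerD hornerN hornerC fmorph_eq0 subr_eq0 => /eqP qt.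
by have := hq t; rewrite -zE qt leNgt l0 => /(_ sz).
Qed.

(** A negative constant [q] is allowed only if the spectrum has no real point;
    then the nonconstant case applies to [- ('X ^+ 2 + 1)] and shows that the
    space is trivial. *)
Lemma poly_op_ge0 (q : {poly R}) T : bounded_op T -> selfadj T ->
  (forall t, spectrum T t%:C -> 0 <= q.[t]) -> forall x, 0 <= rdot (poly_op q T x) x.
Proof.
move=> bT sT hq x; have [sq|] := ltnP 1 (size q); first exact: poly_op_ge0_nonconstant.
move=> /size1_polyC qE; move: hq; rewrite qE; move: (q`_0) => c hc.
rewrite poly_opC rdotZl rdotxx.
have [c0|c0] := leP 0 c; first by rewrite mulr_ge0 ?sqr_ge0.
have nosp t : ~ spectrum T t%:C by move=> /hc; rewrite hornerC leNgt c0.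
have := @poly_op_ge0_nonconstant (- ('X * 'X + 1%:P)) T bT sT _ _ x.
rewrite poly_opN poly_opD poly_opC (poly_opM _ _ _ bT.1) !poly_opX scale1r.
rewrite rdotNl rdotDl selfadjP // !rdotxx oppr_ge0 => h.
have : rnorm (T x) ^+ 2 + rnorm x ^+ 2 <= 0.
  apply: h => [|t /nosp//].
  by rewrite size_polyN size_polyDl ?size_polyC_leq1 -expr2 size_polyXn // size_polyC oner_eq0.
have := sqr_ge0 (rnorm (T x)); have := sqr_ge0 (rnorm x) => h1 h2 h3.
have -> : rnorm x ^+ 2 = 0 by lra.
by rewrite mulr0.
Qed.

(** Apply [poly_op_ge0] to [e ^+ 2 - q ^+ 2]. *)
Lemma poly_op_le (q : {poly R}) T e : bounded_op T -> selfadj T -> 0 <= e ->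
  (forall t, spectrum T t%:C -> `|q.[t]| <= e) -> forall x, rnorm (poly_op q T x) <= e * rnorm x.
Proof.
move=> bT sT e0 hq x; rewrite -ler_sqr ?nnegrE ?rnorm_ge0 ?mulr_ge0 ?rnorm_ge0 //.
have := @poly_op_ge0 ((e ^+ 2)%:P - q * q) T bT sT _ x.
rewrite poly_opD poly_opN poly_opC (poly_opM _ _ _ bT.1) !rdotE.
rewrite selfadjP; last exact: selfadj_poly_op.
rewrite !rdotxx subr_ge0 exprMn; apply=> t st.
rewrite hornerD hornerN hornerC hornerM subr_ge0 -expr2 -[leLHS]real_normK ?num_real //.
by rewrite ler_sqr ?nnegrE ?hq.
Qed.

(** * Functional calculus *)

Lemma fun_calcP f T S : is_fun_calc f T S <->
  bounded_op S /\ forall e, 0 < e -> exists q : {poly R},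
    (forall t, spectrum T t%:C -> `|f t - q.[t]| <= e) /\
    (forall x, rnorm (S x - poly_op q T x) <= e * rnorm x).
Proof.
split=> -[bS hS]; split=> // e /hS[q [h1 h2]]; exists q; split=> // x.
  by rewrite -rnorm_le.
by rewrite rnorm_le.
Qed.

Lemma rnorm_small_eq x y C : (forall e, 0 < e -> rnorm (x - y) <= e * C) -> 0 <= C -> x = y.
Proof.
move=> h C0; apply/eqP; rewrite -subr_eq0 -rnorm_eq0 eq_le rnorm_ge0 andbT.
apply/ler_addgt0Pr => e e0; rewrite add0r.
have C1 : 0 < C + 1 by rewrite ltr_wpDl.
apply: (le_trans (h (e / (C + 1)) _)); first by rewrite divr_gt0.
by rewrite mulrAC ler_pdivrMr // ler_pM2l // lerDl.
Qed.

(** Both operators are norm limits of polynomials of [T] that are close to each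
    other on the spectrum, hence in norm by [poly_op_le]. *)
Lemma fun_calc_unique f g T S S' : bounded_op T -> selfadj T ->
  (forall t, spectrum T t%:C -> f t = g t) ->
  is_fun_calc f T S -> is_fun_calc g T S' -> S = S'.
Proof.
move=> bT sT fg /fun_calcP[_ hS] /fun_calcP[_ hS']; apply/funext => x.
apply: (@rnorm_small_eq _ _ (4 * rnorm x)); last by rewrite mulr_ge0 ?rnorm_ge0.
move=> e e0; have [q [q1 q2]] := hS e e0; have [p [p1 p2]] := hS' e e0.
have qp : rnorm (poly_op (q - p) T x) <= (2 * e) * rnorm x.
  apply: poly_op_le => // [|t st]; first by rewrite mulr_ge0 // ltW.
  have -> : (q - p).[t] = (g t - p.[t]) - (f t - q.[t]).
    by rewrite fg // hornerD hornerN; ring.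
  by apply: (le_trans (ler_normB _ _)); have := q1 t st; have := p1 t st; lra.
move: qp; rewrite poly_opD poly_opN => qp.
have -> : S x - S' x = (S x - poly_op q T x) - (S' x - poly_op p T x) +
    (poly_op q T x - poly_op p T x).
  by rewrite opprB addrAC !addrA !subrK.
apply: (le_trans (rnormD _ _)); have := rnormB (S x - poly_op q T x) (S' x - poly_op p T x).
by have := q2 x; have := p2 x; lra.
Qed.

Lemma fun_calcD f g T S S' : is_fun_calc f T S -> is_fun_calc g T S' ->
  is_fun_calc (fun t => f t + g t) T (S + S').
Proof.
move=> /fun_calcP[bS hS] /fun_calcP[bS' hS']; apply/fun_calcP; split; first exact: boundedD.
move=> e e0; have e2 : 0 < e / 2 by rewrite divr_gt0.
have [q [q1 q2]] := hS _ e2; have [p [p1 p2]] := hS' _ e2.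
exists (q + p); split.
  move=> t st; rewrite hornerD opprD addrACA (le_trans (ler_normD _ _)) //.
  by have := q1 t st; have := p1 t st; lra.
move=> x; rewrite poly_opD !fctE opprD addrACA (le_trans (rnormD _ _)) //.
by have := q2 x; have := p2 x; lra.
Qed.

Lemma fun_calc_poly (q : {poly R}) T : bounded_op T -> is_fun_calc (fun t => q.[t]) T (poly_op q T).
Proof.
move=> bT; apply/fun_calcP; split; first exact: bounded_poly_op.
move=> e e0; exists q; split=> [t _|x]; first by rewrite subrr normr0 ltW.
by rewrite subrr /rnorm normr0 mulr_ge0 ?(ltW e0) // rnorm_ge0.
Qed.

Lemma poly_bound (q : {poly R}) (M : R) : exists B : R, forall t, `|t| <= M -> `|q.[t]| <= B.
Proof.
elim/poly_ind: q => [|q c [B hB]].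
  by exists 0 => t _; rewrite horner0 normr0.
exists (B * M + `|c|) => t tM; rewrite hornerD hornerMX hornerC (le_trans (ler_normD _ _)) //.
by rewrite lerD2r normrM ler_pM ?hB.
Qed.

Lemma spectrum_bounded T : bounded_op T -> selfadj T ->
  exists M, forall t, spectrum T t%:C -> `|t| <= M.
Proof.
move=> bT sT; have [lT [M M0 hM]] := (bounded_opP T).1 bT.
have CS x : rnorm (T x) * rnorm x <= M * rnorm x ^+ 2.
  by rewrite expr2 mulrA ler_wpM2r ?rnorm_ge0.
exists M => t st; rewrite ler_norml; apply/andP; split.
  apply: (spectrum_ge bT sT) st => x.
  by rewrite mulNr lerNl -rdotNl (le_trans (rdot_CS _ _)) // rnormN.
by apply: (spectrum_le bT sT) st => x; apply: (le_trans (rdot_CS _ _)).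
Qed.

Lemma fun_calc_bound f T S : bounded_op T -> selfadj T -> is_fun_calc f T S ->
  exists2 B : R, 0 < B & forall t, spectrum T t%:C -> `|f t| <= B.
Proof.
move=> bT sT /fun_calcP[_ /(_ 1 ltr01)[q [hq _]]].
have [M hM] := spectrum_bounded bT sT; have [B hB] := poly_bound q M.
exists (`|B| + 2) => [|t st]; first by rewrite ltr_wpDl.
have := hq t st; have := hB t (hM t st); have := ler_norm B.
by have := ler_normD (f t - q.[t]) q.[t]; rewrite subrK; lra.
Qed.

(** The error of a product of approximations is controlled by [fun_calc_bound] on
    the spectrum and by the operator bounds in norm. *)
Lemma fun_calcM f g T S S' : bounded_op T -> selfadj T ->
  is_fun_calc f T S -> is_fun_calc g T S' -> is_fun_calc (fun t => f t * g t) T (S \o S').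
Proof.
move=> bT sT fS gS'.
have [Bf Bf0 hBf] := fun_calc_bound bT sT fS.
have [Bg Bg0 hBg] := fun_calc_bound bT sT gS'.
move: fS gS' => /fun_calcP[bS hS] /fun_calcP[bS' hS']; apply/fun_calcP.
split; first exact: bounded_comp.
have [lS [M M0 hM]] := (bounded_opP S).1 bS.
have [lS' [M' M0' hM']] := (bounded_opP S').1 bS'.
move=> e e0; pose K := Bf + Bg + M + M' + 1.
have K0 : 0 < K by rewrite /K; lra.
pose d := Num.min 1 (e / K).
have d0 : 0 < d by rewrite lt_min ltr01 divr_gt0.
have d1 : d <= 1 by rewrite ge_min lexx.
have dK : d * K <= e by rewrite -ler_pdivlMr // ge_min lexx orbT.
have [q [q1 q2]] := hS _ d0; have [p [p1 p2]] := hS' _ d0.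
exists (q * p); split.
  move=> t st; rewrite hornerM.
  have -> : f t * g t - q.[t] * p.[t] = f t * (g t - p.[t]) + (f t - q.[t]) * p.[t] by ring.
  have pB : `|p.[t]| <= Bg + d.
    have -> : p.[t] = g t - (g t - p.[t]) by ring.
    by rewrite (le_trans (ler_normB _ _)) // lerD ?hBg ?p1.
  apply: (le_trans (ler_normD _ _)); rewrite !normrM.
  have h1 : `|f t| * `|g t - p.[t]| <= Bf * d by rewrite ler_pM ?hBf ?p1.
  have h2 : `|f t - q.[t]| * `|p.[t]| <= d * (Bg + d) by rewrite ler_pM ?q1.
  by apply: le_trans dK; apply: (le_trans (lerD h1 h2)); rewrite /K; nra.
move=> x; rewrite (poly_opM _ _ _ bT.1) /=.
have -> : S (S' x) - poly_op q T (poly_op p T x) =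
    S (S' x - poly_op p T x) + (S (poly_op p T x) - poly_op q T (poly_op p T x)).
  by rewrite (linB _ _ lS) addrA subrK.
apply: (le_trans (rnormD _ _)).
have px : rnorm (poly_op p T x) <= (M' + d) * rnorm x.
  have -> : poly_op p T x = S' x - (S' x - poly_op p T x) by rewrite opprB addrC subrK.
  by rewrite mulrDl (le_trans (rnormB _ _)) // lerD.
have h1 : rnorm (S (S' x - poly_op p T x)) <= M * (d * rnorm x).
  by rewrite (le_trans (hM _)) // ler_pM2l.
have h2 : rnorm (S (poly_op p T x) - poly_op q T (poly_op p T x)) <= d * ((M' + d) * rnorm x).
  by rewrite (le_trans (q2 _)) // ler_pM2l.
apply: (le_trans (lerD h1 h2)).
have -> : M * (d * rnorm x) + d * ((M' + d) * rnorm x) = d * (M + M' + d) * rnorm x by ring.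
by rewrite ler_wpM2r ?rnorm_ge0 //; apply: le_trans dK; rewrite ler_pM2l // /K; lra.
Qed.

Lemma fun_calc_ge0 f T S : bounded_op T -> selfadj T -> is_fun_calc f T S ->
  (forall t, spectrum T t%:C -> 0 <= f t) -> forall x, 0 <= rdot (S x) x.
Proof.
move=> bT sT /fun_calcP[bS hS] f0 x; rewrite -oppr_le0; apply/ler_addgt0Pr => e e0.
rewrite add0r; have n1 : 0 < 2 * rnorm x ^+ 2 + 1 by rewrite ltr_wpDl // mulr_ge0 ?sqr_ge0.
pose d := e / (2 * rnorm x ^+ 2 + 1); have d0 : 0 < d by apply: divr_gt0.
have [q [q1 q2]] := hS _ d0.
have := @poly_op_ge0 (q + d%:P) T bT sT _ x.
rewrite poly_opD poly_opC !rdotE rdotxx => h.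
have {}h : 0 <= rdot (poly_op q T x) x + d * rnorm x ^+ 2.
  apply: h => t st; rewrite hornerD hornerC.
  by have := q1 t st; have := f0 t st; rewrite ler_norml => ? /andP[]; lra.
have h2 : rdot (poly_op q T x - S x) x <= d * rnorm x ^+ 2.
  rewrite (le_trans (rdot_CS _ _)) // expr2 mulrA ler_wpM2r ?rnorm_ge0 //.
  by rewrite rnormBC.
move: h2; rewrite rdotBl => h2.
have : d * (2 * rnorm x ^+ 2) <= e.
  by rewrite /d mulrAC ler_pdivrMr // ler_pM2l // lerDl.
by lra.
Qed.

Lemma rdot_selfadj S : linear S -> (forall x y, rdot (S x) y = rdot x (S y)) -> selfadj S.
Proof.
move=> lS h x y; have := h x y; have := h x ('i%C *: y).
rewrite (linZ _ _ lS) /rdot !linearZr_LR /=.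
case: (dot (S x) y) => a b; case: (dot x (S y)) => c d /=.
by rewrite !mul0r !sub0r !mulN1r !opprK => -> ->.
Qed.

Lemma fun_calc_selfadj f T S : bounded_op T -> selfadj T -> is_fun_calc f T S -> selfadj S.
Proof.
move=> bT sT /fun_calcP[bS hS]; apply: rdot_selfadj; first exact: bS.1.
move=> x y; apply/eqP; rewrite -subr_eq0 -normr_eq0 eq_le normr_ge0 andbT.
apply/ler_addgt0Pr => e e0; rewrite add0r.
have xy0 : 0 <= rnorm x * rnorm y by rewrite mulr_ge0 ?rnorm_ge0.
have n1 : 0 < 2 * (rnorm x * rnorm y) + 1 by lra.
pose d := e / (2 * (rnorm x * rnorm y) + 1); have d0 : 0 < d by apply: divr_gt0.
have [q [q1 q2]] := hS _ d0.
have de : d * (2 * (rnorm x * rnorm y)) <= e.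
  by rewrite /d mulrAC ler_pdivrMr // ler_pM2l // lerDl.
have sq := selfadjP x y (selfadj_poly_op q bT sT).
have a1 : rdot (S x - poly_op q T x) y <= d * (rnorm x * rnorm y).
  by rewrite (le_trans (rdot_CS _ _)) // mulrA ler_wpM2r ?rnorm_ge0.
have a2 : rdot (- (S x - poly_op q T x)) y <= d * (rnorm x * rnorm y).
  by rewrite (le_trans (rdot_CS _ _)) // rnormN mulrA ler_wpM2r ?rnorm_ge0.
have a3 : rdot x (S y - poly_op q T y) <= d * (rnorm x * rnorm y).
  by rewrite (le_trans (rdot_CS _ _)) // mulrCA ler_wpM2l ?rnorm_ge0.
have a4 : rdot x (- (S y - poly_op q T y)) <= d * (rnorm x * rnorm y).
  by rewrite (le_trans (rdot_CS _ _)) // rnormN mulrCA ler_wpM2l ?rnorm_ge0.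
move: a1 a2 a3 a4; rewrite !rdotE sq => a1 a2 a3 a4.
by rewrite ler_norml; apply/andP; split; lra.
Qed.

(** The values at [x] of approximating polynomials of [T] form a Cauchy sequence,
    by [poly_op_le]; the bound is uniform in [x], so linearity and boundedness
    pass to the limit. *)
Lemma fun_calc_exists f T : bounded_op T -> selfadj T ->
  (forall e, 0 < e -> exists q : {poly R}, forall t, spectrum T t%:C -> `|f t - q.[t]| <= e) ->
  exists S, is_fun_calc f T S.
Proof.
move=> bT sT hf; pose d n : R := n.+1%:R^-1.
have d0 n : 0 < d n by rewrite invr_gt0.
have [q hq] := choice (fun n => hf _ (d0 n)).
have dle N n : (N <= n)%N -> d n <= d N by move=> h; rewrite lef_pV2 ?posrE // ler_nat.
have dsmall e : 0 < e -> exists N, d N <= e.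
  move=> e0; have /cvgrPdist_le /(_ _ e0)[N _ hN] := @cvg_harmonic R.
  exists N; have := hN N (leqnn _); rewrite /= sub0r normrN ger0_norm // ltW.
have cau n N x : (N <= n)%N -> rnorm (poly_op (q n) T x - poly_op (q N) T x) <= (2 * d N) * rnorm x.
  move=> Nn; rewrite -poly_opN -poly_opD; apply: poly_op_le => // [|t st].
    by rewrite mulr_ge0 // ltW.
  have -> : (q n - q N).[t] = (f t - (q N).[t]) - (f t - (q n).[t]).
    by rewrite hornerD hornerN; ring.
  apply: (le_trans (ler_normB _ _)).
  by have := hq n t st; have := hq N t st; have := dle _ _ Nn; lra.
have lim x : exists l, forall n, rnorm (l - poly_op (q n) T x) <= (2 * d n) * rnorm x.
  have [|l hl] := @cauchy_seq_cvg (fun n => poly_op (q n) T x).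
    move=> e e0; have x1 : 0 < 2 * (rnorm x + 1) by rewrite mulr_gt0 // ltr_wpDl // rnorm_ge0.
    have [N hN] := dsmall _ (divr_gt0 e0 x1); exists N => n Nn.
    apply: (le_trans (cau _ _ _ Nn)); move: hN; rewrite ler_pdivlMr //.
    by apply: le_trans; have := d0 N; have := rnorm_ge0 x; nra.
  exists l => n; apply/ler_addgt0Pr => e e0; have [N hN] := hl _ e0.
  pose k := maxn N n.
  have -> : l - poly_op (q n) T x = (poly_op (q k) T x - poly_op (q n) T x) - (poly_op (q k) T x - l).
    by rewrite opprB [RHS]addrC addrA subrK.
  apply: (le_trans (rnormB _ _)); rewrite lerD ?cau ?leq_maxr //.
  by rewrite hN // leq_maxl.
have [S hS] := choice lim.
have bq n := bounded_poly_op (q n) bT.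
have lS : linear S.
  move=> a x y; pose C := rnorm (a *: x + y) + complex.Re `|a| * rnorm x + rnorm y.
  have a0 : 0 <= complex.Re `|a| by have := normr_ge0 a; rewrite lecE => /andP[].
  apply: (@rnorm_small_eq _ _ (2 * C)); last first.
    by rewrite /C mulr_ge0 // !addr_ge0 ?rnorm_ge0 // mulr_ge0 ?rnorm_ge0.
  move=> e e0; have [n hn] := dsmall _ e0.
  have -> : S (a *: x + y) - (a *: S x + S y) =
     (S (a *: x + y) - poly_op (q n) T (a *: x + y)) - (a *: (S x - poly_op (q n) T x)
       + (S y - poly_op (q n) T y)).
    rewrite (bq n).1 scalerBr addrACA -opprD opprB addrA subrK.
    by [].
  have C0 : 0 <= C by rewrite /C !addr_ge0 ?rnorm_ge0 // mulr_ge0 ?rnorm_ge0.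
  apply: (@le_trans _ _ (d n * (2 * C))); last by rewrite ler_wpM2r // mulr_ge0.
  apply: (le_trans (rnormB _ _)).
  have := rnormD (a *: (S x - poly_op (q n) T x)) (S y - poly_op (q n) T y); rewrite rnormZ.
  have := hS (a *: x + y) n; have := ler_wpM2l a0 (hS x n); have := hS y n.
  by rewrite /C; lra.
exists S; apply/fun_calcP; split.
  apply/bounded_opP; split=> //.
  have [_ [M M0 hM]] := (bounded_opP _).1 (bq 0%N).
  exists (M + 2 * d 0%N); first by rewrite addr_gt0 // mulr_gt0.
  move=> x; rewrite -[S x](subrK (poly_op (q 0%N) T x)) mulrDl addrC.
  by rewrite (le_trans (rnormD _ _)) // lerD.
move=> e e0; have [n hn] := dsmall _ (divr_gt0 e0 (ltr0Sn _ 1)); exists (q n); split.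
  by move=> t st; apply: (le_trans (hq n t st)); lra.
by move=> x; rewrite (le_trans (hS x n)) // ler_wpM2r ?rnorm_ge0 //; lra.
Qed.
Lemma fun_calc_id T : bounded_op T -> is_fun_calc (fun t => t) T T.
Proof.
move=> /(fun_calc_poly 'X).
have -> : poly_op ('X : {poly R}) T = T by apply/funext => x; rewrite poly_opX.
by have -> : (fun t => ('X : {poly R}).[t]) = id by apply/funext => t; rewrite hornerX.
Qed.

Lemma fun_calcZ a f T S : bounded_op T -> selfadj T -> is_fun_calc f T S ->
  is_fun_calc (fun t => a * f t) T (a%:C *: S).
Proof.
move=> bT sT fS; have := fun_calcM bT sT (fun_calc_poly a%:P bT) fS.
have -> : poly_op a%:P T \o S = a%:C *: S by apply/funext => x; rewrite /= poly_opC.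
by have -> : (fun t => a%:P.[t] * f t) = (fun t => a * f t)
  by apply/funext => t; rewrite hornerC.
Qed.

Lemma fun_calc_1 T : bounded_op T -> is_fun_calc (fun=> 1) T idfun.
Proof.
move=> /(fun_calc_poly 1%:P).
have -> : poly_op (1%:P : {poly R}) T = idfun.
  by apply/funext => x; rewrite poly_opC scale1r.
by have -> : (fun t => (1%:P : {poly R}).[t]) = (fun=> 1) by apply/funext => t; rewrite hornerC.
Qed.

Lemma fun_calcB f g T S S' : bounded_op T -> selfadj T ->
  is_fun_calc f T S -> is_fun_calc g T S' -> is_fun_calc (fun t => f t - g t) T (S - S').
Proof.
move=> bT sT fS /(fun_calcZ (-1) bT sT) /(fun_calcD fS).
rewrite rmorphN scaleN1r.
by under [X in is_fun_calc X]funext do rewrite mulN1r.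
Qed.

(** [op_pow] is a choice, so the existence of the calculus is needed here: the
    spectrum lies in a compact interval of positive reals, on which powers are
    uniform limits of polynomials. *)
Lemma op_powP T p m : bounded_op T -> selfadj T -> 0 < m ->
  (forall x, m * rnorm x ^+ 2 <= rdot (T x) x) -> is_fun_calc (fun t => t `^ p) T (op_pow T p).
Proof.
move=> bT sT m0 hT; have [M hM] := spectrum_bounded bT sT.
have [S hS] : exists S, is_fun_calc (fun t => t `^ p) T S.
  apply: fun_calc_exists => // e e0.
  have mM : m < `|M| + m + 1 by have := normr_ge0 M; lra.
  have [q hq] := weierstrass mM (@powR_quadratic_modulus R p m _ m0) e0.
  exists q => t st; apply: hq; rewrite (spectrum_ge bT sT hT st) /=.
  by have := hM t st; have := ler_norm t; have := ler_norm M; lra.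
by rewrite /op_pow /fun_calc; exact: (@xgetI _ _ _ S).
Qed.

(** Substitution: if [t] is in the spectrum of [T], then [(1 + t) / 2] is in that
    of [(1 + T) / 2], and approximating polynomials are composed with the affine
    map. *)
Lemma fun_calc_midpoint g T S : bounded_op T ->
  is_fun_calc g (2^-1 *: (idfun + T)) S -> is_fun_calc (fun t => g (2^-1 * (1 + t))) T S.
Proof.
move=> bT /fun_calcP[bS hS]; apply/fun_calcP; split=> // e /hS[q [q1 q2]].
have two : 2^-1 = (2^-1 : R)%:C by rewrite fmorphV rmorph_nat.
pose w : {poly R} := 2^-1 *: (1%:P + 'X).
have wE : poly_op w T = 2^-1 *: (idfun + T).
  by apply/funext => x; rewrite poly_opZ poly_opD poly_opC poly_opX scale1r -two.
exists (q \Po w); split=> [t st|x].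
  rewrite horner_comp /w hornerZ hornerD hornerC hornerX; apply: q1.
  apply: contra_not st => inv2.
  have -> : t%:C *: idfun - T =
      2 *: ((2^-1 * (1 + t))%:C *: idfun - 2^-1 *: (idfun + T)).
    rewrite scalerBr !scalerA mulfV ?scale1r; last by rewrite pnatr_eq0.
    rewrite rmorphM /= -two mulrA mulfV ?mul1r; last by rewrite pnatr_eq0.
    by rewrite rmorphD /= scalerDl scale1r opprD addrACA subrr add0r.
  apply: invertibleZ => //.
  apply: (boundedB _ _).1; first exact/boundedZ/bounded_id.
  by apply/boundedZ/boundedD => //; exact: bounded_id.
by rewrite (poly_op_comp _ _ _ bT.1) wE.
Qed.

(** * Congruence by the square root *)

Lemma op_inv_unique T S : is_inverse T S -> op_inv T = S.
Proof.
move=> hS; have : is_inverse T (op_inv T) by exact: (@xgetI _ _ _ S hS).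
case: hS => _ ST TS [_ GT TG]; apply/funext => x.
have -> : op_inv T x = op_inv T (T (S x)) by have /(congr1 (@^~ x)) /= -> := TS.
by have /(congr1 (@^~ (S x))) /= -> := GT.
Qed.

Lemma positive_conj E F : bounded_op E -> selfadj E -> bounded_op F -> selfadj F ->
  (forall x, 0 <= rdot (F x) x) -> positive_op dot (E \o F \o E).
Proof.
move=> bE sE bF sF pF; apply: selfadj_pos.
- by apply: bounded_comp => //; apply: bounded_comp.
- by move=> x y /=; rewrite sE sF sE.
by move=> x /=; rewrite selfadjP.
Qed.

Lemma strictly_positive_lower A : strictly_positive dot A ->
  [/\ bounded_op A, selfadj A &
    exists2 m, 0 < m & forall x, m * rnorm x ^+ 2 <= rdot (A x) x].
Proof.
move=> [pA iA]; have sA := pos_selfadj pA; have bA := pA.1; split=> //.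
by apply: pos_invertible_lower => // x; exact: pos_rdot.
Qed.

Section Congruence.
Variables (A B : H -> H).
Hypotheses (pA : strictly_positive dot A) (pB : strictly_positive dot B).
Hypothesis AB : op_le dot A B.
Let E := op_pow A (1 / 2).
Let D := op_pow A (- (1 / 2)).
Let X := D \o B \o D.

(** Identities between scalar powers on the spectrum give identities between
    powers of [A], by uniqueness of the calculus. *)
Lemma sqrt_and_inverse_sqrt : [/\ bounded_op E /\ selfadj E, bounded_op D /\ selfadj D,
  E \o E = A, E \o D = idfun & D \o E = idfun].
Proof.
have [bA sA [m m0 hm]] := strictly_positive_lower pA.
have hE : is_fun_calc (fun t => t `^ (1 / 2)) A E by exact: (op_powP _ bA sA m0 hm).
have hD : is_fun_calc (fun t => t `^ (- (1 / 2))) A D by exact: (op_powP _ bA sA m0 hm).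
have sp t : spectrum A t%:C -> 0 < t.
  by move=> st; apply: lt_le_trans m0 (spectrum_ge bA sA hm st).
split.
- by split; [case/fun_calcP: hE | exact: (fun_calc_selfadj bA sA hE)].
- by split; [case/fun_calcP: hD | exact: (fun_calc_selfadj bA sA hD)].
- apply: (fun_calc_unique bA sA _ (fun_calcM bA sA hE hE) (fun_calc_id bA)).
  by move=> t /sp t0; rewrite -expr2 -powR_half_sqr // ltW.
- apply: (fun_calc_unique bA sA _ (fun_calcM bA sA hE hD) (fun_calc_1 bA)).
  by move=> t /sp t0; rewrite powRN divff // gt_eqF // powR_gt0.
apply: (fun_calc_unique bA sA _ (fun_calcM bA sA hD hE) (fun_calc_1 bA)).
by move=> t /sp t0; rewrite powRN mulVf // gt_eqF // powR_gt0.
Qed.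

(** [X >= 1] is the inequality [A <= B] evaluated at [D x]. *)
Lemma congruence_ge1 : [/\ bounded_op X, selfadj X,
   forall x, rnorm x ^+ 2 <= rdot (X x) x & B = E \o X \o E].
Proof.
have [[bE sE] [bD sD] EE ED DE] := sqrt_and_inverse_sqrt.
have [[bB _] sB] := (pB.1, pos_selfadj pB.1).
have EDx x : E (D x) = x by have /(congr1 (@^~ x)) := ED.
have DEx x : D (E x) = x by have /(congr1 (@^~ x)) := DE.
split.
- by apply: bounded_comp => //; apply: bounded_comp.
- by move=> x y; rewrite /X /= sD sB sD.
- move=> x; rewrite /X /= selfadjP //.
  have := pos_rdot (D x) AB; rewrite !fctE rdotBl subr_ge0; apply: le_trans.
  by rewrite -EE /= selfadjP // EDx rdotxx.
by apply/funext => x; rewrite /X /= DEx EDx.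
Qed.

(** [op_inv A] is [D \o D], so the outer factors [E] and [D] cancel. *)
Lemma quotient_conj x : ((B - A) \o op_inv A) (E x) = E ((X - idfun) x).
Proof.
have [[bE sE] [bD sD] EE ED DE] := sqrt_and_inverse_sqrt.
have [bX sX X1 BE] := congruence_ge1.
have EDx y : E (D y) = y by have /(congr1 (@^~ y)) := ED.
have DEx y : D (E y) = y by have /(congr1 (@^~ y)) := DE.
have -> : op_inv A = D \o D.
  apply: op_inv_unique; split; first exact: bounded_comp.
    by apply/funext => y; rewrite -EE /= !DEx.
  by apply/funext => y; rewrite -EE /= !EDx.
rewrite /= DEx !fctE {1}BE -{1}EE /= EDx.
by rewrite (linB _ _ bE.1).
Qed.

Lemma gap_conj Q x :
  (A + B - 2 *: (E \o Q \o E)) x = E ((idfun + X - 2 *: Q) (E x)).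
Proof.
have [[bE sE] [bD sD] EE ED DE] := sqrt_and_inverse_sqrt.
have [bX sX X1 BE] := congruence_ge1.
rewrite !fctE (linB _ _ bE.1) (linD bE.1) (linZ _ _ bE.1) {1}BE -{1}EE /=.
by [].
Qed.

Lemma diff_conj P x : (A - (E \o P \o E)) x = E ((idfun - P) (E x)).
Proof.
have [[bE sE] [bD sD] EE ED DE] := sqrt_and_inverse_sqrt.
by rewrite !fctE (linB _ _ bE.1) -{1}EE.
Qed.

(** The reduction to scalars: two operators that are congruent through [E] to
    functions of [X] compare as these functions do on [1, +oo[, once the common
    summand [S] is cancelled. *)
Lemma op_le_conj L M S F G h :
  (forall x, L x = E (F (E x))) -> (forall x, M x = E (G (E x))) ->
  is_fun_calc h X (G - F) -> (forall t, 1 <= t -> 0 <= h t) -> op_le dot (L + S) (M + S).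
Proof.
have [[bE sE] _ _ _ _] := sqrt_and_inverse_sqrt; have [bX sX X1 _] := congruence_ge1.
move=> hL hM hFG h0; rewrite /op_le.
have -> : M + S - (L + S) = E \o (G - F) \o E.
  apply/funext => x; rewrite opprD addrACA subrr addr0 /= !fctE hL hM.
  by rewrite (linB _ _ bE.1).
apply: positive_conj => //; first by case: hFG.
  exact: (fun_calc_selfadj bX sX hFG).
apply: (fun_calc_ge0 bX sX hFG) => t st; apply: h0.
by apply: (spectrum_ge bX sX _ st) => x; rewrite mul1r.
Qed.

Lemma op_pow_congruence p : is_fun_calc (fun t => t `^ p) X (op_pow X p).
Proof.
have [bX sX X1 _] := congruence_ge1.
by apply: (op_powP _ bX sX ltr01) => x; rewrite mul1r.
Qed.

Lemma op_pow_midpoint p :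
  is_fun_calc (fun t => (2^-1 * (1 + t)) `^ p) X (op_pow (2^-1 *: (idfun + X)) p).
Proof.
have [bX sX X1 _] := congruence_ge1.
have two : 2^-1 = (2^-1 : R)%:C by rewrite fmorphV rmorph_nat.
apply: (@fun_calc_midpoint (fun t => t `^ p)) => //; apply: (@op_powP _ _ 1) => //.
- by apply/boundedZ/boundedD => //; exact: bounded_id.
- by rewrite two; apply/selfadjZ/selfadjD.
move=> x; rewrite two !fctE !rdotE rdotxx mul1r /=.
by have := X1 x; lra.
Qed.

Lemma gap_fun_calc (k : R) : is_fun_calc (fun t => k * (1 + t - 2 * t `^ (1 / 2))) X
  (k%:C *: (idfun + X - 2 *: op_pow X (1 / 2))).
Proof.
have [bX sX X1 _] := congruence_ge1.
have two : 2 = (2 : R)%:C by rewrite rmorph_nat.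
rewrite two; apply: fun_calcZ => //; apply: fun_calcB => //.
  by apply: fun_calcD; [exact: fun_calc_1 | exact: fun_calc_id].
by apply: fun_calcZ => //; exact: op_pow_congruence.
Qed.

Lemma quotient_fun_calc (k : R) f S : is_fun_calc f X S ->
  is_fun_calc (fun t => k * ((t - 1) * f t)) X (k%:C *: ((X - idfun) \o S)).
Proof.
have [bX sX X1 _] := congruence_ge1 => hS.
apply: fun_calcZ => //; apply: fun_calcM => //; apply: fun_calcB => //.
  exact: fun_calc_id.
exact: fun_calc_1.
Qed.

Lemma gap_le_power_defect v : 3 / 4 <= v <= 1 ->
  op_le dot
    ((Num.min v (1 - v))%:C *: (A + B - 2 *: gmean A B) + sharp v A B)
    (v%:C *: ((B - A) \o op_inv A \o (2^-1 *: (A - natural (v - 1) A B))) + sharp v A B).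
Proof.
move=> hv; have [bX sX X1 _] := congruence_ge1.
have [[bE sE] _ _ _ _] := sqrt_and_inverse_sqrt.
have two : 2^-1 = (2^-1 : R)%:C by rewrite fmorphV rmorph_nat.
set k := Num.min _ _.
apply: (@op_le_conj _ _ _ (k%:C *: (idfun + X - 2 *: op_pow X (1 / 2)))
  (v%:C *: ((X - idfun) \o (2^-1 *: (idfun - op_pow X (v - 1)))))
  (fun t => v * ((t - 1) * (2^-1 * (1 - t `^ (v - 1)))) - k * (1 + t - 2 * t `^ (1 / 2)))).
- by move=> x; rewrite [in RHS]fctE (linZ _ _ bE.1) -gap_conj.
- move=> x; rewrite [in RHS]fctE (linZ _ _ bE.1) /= -quotient_conj [in RHS]fctE.
  by rewrite (linZ _ _ bE.1) -diff_conj.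
- apply: fun_calcB => //; last exact: gap_fun_calc.
  apply: quotient_fun_calc; rewrite two; apply: fun_calcZ => //; apply: fun_calcB => //.
    exact: fun_calc_1.
  exact: op_pow_congruence.
by move=> t t1; rewrite subr_ge0; exact: gap_le_power_defect_scalar.
Qed.

(** Both ranges of [v] lead to the same operator inequality and differ only in
    the proof of the scalar one. *)
Lemma midpoint_defect_le_gap v :
  (forall t, 1 <= t -> v * ((t - 1) * (1 - (2^-1 * (1 + t)) `^ (v - 1))) <=
    Num.max v (1 - v) * (1 + t - 2 * t `^ (1 / 2))) ->
  op_le dot
    (v%:C *: ((B - A) \o op_inv A \o
       (A - (E \o op_pow (2^-1 *: (idfun + X)) (v - 1) \o E))) + sharp v A B)
    ((Num.max v (1 - v))%:C *: (A + B - 2 *: gmean A B) + sharp v A B).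
Proof.
move=> hv; have [bX sX X1 _] := congruence_ge1.
have [[bE sE] _ _ _ _] := sqrt_and_inverse_sqrt.
set k := Num.max _ _ in hv *.
apply: (@op_le_conj _ _ _
  (v%:C *: ((X - idfun) \o (idfun - op_pow (2^-1 *: (idfun + X)) (v - 1))))
  (k%:C *: (idfun + X - 2 *: op_pow X (1 / 2)))
  (fun t => k * (1 + t - 2 * t `^ (1 / 2)) - v * ((t - 1) * (1 - (2^-1 * (1 + t)) `^ (v - 1))))).
- move=> x; rewrite [in RHS]fctE (linZ _ _ bE.1) /= -quotient_conj.
  by rewrite -diff_conj.
- by move=> x; rewrite [in RHS]fctE (linZ _ _ bE.1) -gap_conj.
- apply: fun_calcB => //; first exact: gap_fun_calc.
  apply: quotient_fun_calc; apply: fun_calcB => //.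
    exact: fun_calc_1.
  exact: op_pow_midpoint.
by move=> t t1; rewrite subr_ge0; exact: hv.
Qed.
End Congruence.
End HilbertOperators.

Theorem proposition3p1 (R : realType) :
  (* (I) *)
  (forall (H : completeNormedModType R[i]) (dot : {dot H for @Num.conj R[i]}),
    hilbert dot ->
    [/\ (* (i) *)
        forall (v : R) (A B : H -> H), 3 / 4 <= v <= 1 ->
          strictly_positive dot A -> strictly_positive dot B ->
          op_le dot A B ->
          op_le dot
            ((Num.min v (1 - v))%:C *: (A + B - 2 *: gmean A B) + sharp v A B)
            (v%:C *: ((B - A) \o op_inv A \o
                      (2^-1 *: (A - natural (v - 1) A B)))
             + sharp v A B),
        (* (ii) *)
        forall (v : R) (A B : H -> H), 2 / 3 <= v <= 1 ->
          strictly_positive dot A -> strictly_positive dot B ->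
          op_le dot A B ->
          op_le dot
            (v%:C *: ((B - A) \o op_inv A \o
               (A - (op_pow A (1 / 2) \o
                     op_pow (2^-1 *: (idfun + (op_pow A (- (1 / 2)) \o B \o
                                               op_pow A (- (1 / 2)))))
                            (v - 1) \o
                     op_pow A (1 / 2))))
             + sharp v A B)
            ((Num.max v (1 - v))%:C *: (A + B - 2 *: gmean A B) + sharp v A B)
      & (* (iii) *)
        forall (v : R) (A B : H -> H), 0 <= v <= 1 / 3 ->
          strictly_positive dot A -> strictly_positive dot B ->
          op_le dot A B ->
          op_le dot
            (v%:C *: ((B - A) \o op_inv A \o
               (A - (op_pow A (1 / 2) \o
                     op_pow (2^-1 *: (idfun + (op_pow A (- (1 / 2)) \o B \o
                                               op_pow A (- (1 / 2)))))
                            (v - 1) \o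
                     op_pow A (1 / 2))))
             + sharp v A B)
            ((Num.max v (1 - v))%:C *: (A + B - 2 *: gmean A B) + sharp v A B)
    ]) /\
  (* (II) *)
  (forall v x : R, 0 <= v <= 1 -> 0 < x -> 1 / 2 <= x `^ v ->
    upper_M v x <= kantorovich x) /\
  (* (III) *)
  (forall v x : R, 0 <= v <= 1 / 2 -> 0 < x <= 1 ->
    upper_M v x <= expR (4 * v * (1 - v) * (kantorovich x - 1))) /\
  (* (IV) *)
  [/\ exists v x : R, [/\ 0 <= v <= 1, 0 < x <= 1 &
        kantorovich x `^ Num.min v (1 - v) < lower_m v x],
      exists v x : R, [/\ 0 <= v <= 1, 0 < x <= 1 &
        lower_m v x < kantorovich x `^ Num.min v (1 - v)],
      exists v x : R, [/\ 0 <= v <= 1, 0 < x <= 1 &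
        upper_M v x < kantorovich x `^ Num.max v (1 - v)]
    & exists v x : R, [/\ 0 <= v <= 1, 0 < x <= 1 &
        kantorovich x `^ Num.max v (1 - v) < upper_M v x]].
Proof.
split; last split; last split; last split.
- move=> H dot hd; split=> v A B hv pA pB AB.
  + exact: (gap_le_power_defect hd pA pB AB hv).
  + by apply: (midpoint_defect_le_gap hd pA pB AB) => t t1; exact: midpoint_defect_le_gap_large.
  + by apply: (midpoint_defect_le_gap hd pA pB AB) => t t1; exact: midpoint_defect_le_gap_small.
- exact: upper_M_le_kantorovich.
- exact: upper_M_le_expR.
- exact: lower_m_gt_kantorovich_powR.
- exact: lower_m_lt_kantorovich_powR.
- exact: upper_M_lt_kantorovich_powR.
- exact: kantorovich_powR_lt_upper_M.
Qed.
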